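(* Let $k\ge1$ be a fixed integer, $\lambda_1,\dots,\lambda_k>0$, and consider the risk model $X(t)=ct-\sum_{j=1}^{M(t)}Z_j$, $t\ge0$, where $c>0$ is the constant premium rate, $\{M(t)\}_{t\ge0}$ is the generalized counting process with rates $\lambda_1,\dots,\lambda_k$, and $\{Z_j\}_{j\ge1}$ is a sequence of positive iid random variables (the claim sizes) with common distribution $F$, independent of $\{M(t)\}_{t\ge0}$. Let $\mu=\mathbb{E}(Z_j)$. Then the ruin probability for zero initial capital is given by $$\psi(0)=\frac{\mu}{c}\sum_{j=1}^{k}j\lambda_{j}.$$
   Context: The generalized counting process (GCP) $\{M(t)\}_{t\ge0}$ with rates $\lambda_1,\dots,\lambda_k>0$ is the compound Poisson process (Lévy process started at $0$) with jumps of sizes $1,\dots,k$ occurring at rates $\lambda_1,\dots,\lambda_k$ respectively; i.e. $M(t)\overset{d}{=}\sum_{i=1}^{N(t)}X_i$ with $\{N(t)\}_{t\ge0}$ a Poisson process of intensity $\Lambda=\lambda_1+\dots+\lambda_k$ independent of the iid sequence $\{X_i\}_{i\ge1}$ with $\mathrm{Pr}\{X_1=j\}=\lambda_j/\Lambda$, $j=1,\dots,k$. For initial capital $u\ge0$ the surplus process is $U(t)=u+X(t)$, the time to ruin is $\tau=\inf\{t>0:U(t)<0\}$ with $\inf\emptyset=\infty$, and the ruin probability is $\psi(u)=\mathrm{Pr}\{\tau<\infty\}$.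
   Formalization: The formal theorem assumes that μ is finite and that the net profit condition μ·Σ jλ_j ≤ c holds; otherwise the right-hand side exceeds 1 and cannot equal the probability ψ(0) (e.g. k=1, λ_1=1, c=1, Z_j=2). *)

(* Defs.v *)
From HB Require Import structures.
From mathcomp Require Import all_boot all_order all_algebra.
From mathcomp Require Import all_classical all_reals all_analysis.

Set Implicit Arguments.
Unset Strict Implicit.
Unset Printing Implicit Defensive.

Import Order.TTheory GRing.Theory Num.Theory.
Import numFieldNormedType.Exports.

Local Open Scope classical_set_scope.
Local Open Scope ring_scope.

Section independence.
Context {d d1 d2 : measure_display} {T : measurableType d}
  {T1 : measurableType d1} {T2 : measurableType d2} {R : realType}.
Variable P : probability T R.

Definition mutually_independent (I : eqType) (X : I -> T -> T1) : Prop :=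
  forall (s : seq I) (B : I -> set T1), uniq s ->
    (forall i, measurable (B i)) ->
    P (\bigcap_(i in [set` s]) (X i @^-1` B i)) =
    (\prod_(i <- s) P (X i @^-1` B i))%E.

Definition generated_sigma_algebra (I : Type) (D : set I) (X : I -> T -> T1) :
    set_system T :=
  <<s \bigcup_(i in D) preimage_set_system setT (X i) measurable >>.

End independence.

Definition independent_families {d d1 d2 : measure_display}
    {T : measurableType d} {T1 : measurableType d1} {T2 : measurableType d2}
    {R : realType} (P : probability T R)
    (I J : Type) (D : set I) (X : I -> T -> T1) (E : set J) (Y : J -> T -> T2)
    : Prop :=
  forall A B : set T,
    generated_sigma_algebra D X A -> generated_sigma_algebra E Y B ->
    P (A `&` B) = (P A * P B)%E.

Section processes.
Context {d : measure_display} {T : measurableType d} {R : realType}.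
Variable P : probability T R.

(* A process indexed by [0, +oo[ is represented by a family indexed by R whose
   values at negative times are never constrained nor used. *)
Definition nneg_times : set R := [set t | 0 <= t].

Definition cadlag (f : R -> R) : Prop :=
  (forall t, 0 <= t -> f s @[s --> t^'+] --> f t) /\
  (forall t, 0 < t -> cvg (f s @[s --> t^'-])).

(* The infinite time sequence covers finite partitions t_0 <= ... <= t_n too:
   mutual independence only concerns finite subfamilies. *)
Definition independent_increments (X : R -> T -> R) : Prop :=
  forall t : nat -> R, 0 <= t 0%N -> {homo t : m n / (m <= n)%N >-> m <= n} ->
    mutually_independent P (fun (i : nat) w => X (t i.+1) w - X (t i) w).

Definition stationary_increments (X : R -> T -> R) : Prop :=
  forall (s t : R) (B : set R), 0 <= s -> 0 <= t -> measurable B ->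
    P [set w | B (X (s + t) w - X s w)] = P [set w | B (X t w - X 0 w)].

Definition levy_process (X : R -> T -> R) : Prop :=
  [/\ forall t, 0 <= t -> measurable_fun setT (X t),
      forall w, X 0 w = 0,
      independent_increments X,
      stationary_increments X &
      forall w, cadlag (X ^~ w)].

(* The marginal law is only imposed for t > 0: at t = 0 it follows from
   N 0 = 0, while [poisson_pmf 0] is not the Dirac mass at 0. *)
Definition poisson_process (rate : R) (N : R -> {RV P >-> nat}) : Prop :=
  levy_process (fun t w => (N t w)%:R) /\
  forall (t : R) (n : nat), 0 < t ->
    distribution P (N t) [set n] = (poisson_pmf (rate * t) n)%:E.

End processes.

Section gcp.
Context {d : measure_display} {T : measurableType d} {R : realType}.
Variable P : probability T R.

(* [lambda j], j < k, is the rate of the jumps of size j + 1, and [X i] is the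
   (i + 1)-th jump; N and X may live on another probability space. *)
Definition generalized_counting_process (k : nat) (lambda : 'I_k -> R)
    (M : R -> {RV P >-> nat}) : Prop :=
  let Lambda := \sum_(j < k) lambda j in
  levy_process P (fun t w => (M t w)%:R) /\
  exists (d' : measure_display) (T' : measurableType d')
      (P' : probability T' R)
      (N : R -> {RV P' >-> nat}) (X : nat -> {RV P' >-> nat}),
    [/\ poisson_process Lambda N,
        mutually_independent P' (fun i => X i : T' -> nat),
        forall (i : nat) (j : 'I_k),
          distribution P' (X i) [set j.+1] = (lambda j / Lambda)%:E,
        independent_families P' (@nneg_times R) (fun t => N t : T' -> nat)
          [set: nat] (fun i => X i : T' -> nat) &
        forall (t : R) (A : set nat), 0 <= t ->
          distribution P (M t) A =
          P' [set w | A (\sum_(i < N t w) X i w)%N]].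

(* [Z j] is the (j + 1)-th claim size. *)
Definition risk_process (c : R) (M : R -> T -> nat) (Z : nat -> T -> R)
    (t : R) (w : T) : R :=
  c * t - \sum_(j < M t w) Z j w.

Definition surplus (u : R) (X : R -> T -> R) (t : R) (w : T) : R := u + X t w.

Definition ruin_time (U : R -> T -> R) (w : T) : \bar R :=
  ereal_inf [set t%:E | t in [set t : R | 0 < t /\ U t w < 0]].

Definition ruin_probability (X : R -> T -> R) (u : R) : \bar R :=
  P [set w | (ruin_time (surplus u X) w < +oo)%E].

End gcp.

(* Main.v *)
From HB Require Import structures.
Require Import Defs.
From mathcomp Require Import all_boot all_order all_algebra.
From mathcomp Require Import all_classical all_reals all_analysis.
From mathcomp Require Import measurable_realfun ring lra.

Set Implicit Arguments.
Unset Strict Implicit.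
Unset Printing Implicit Defensive.

Import Order.TTheory GRing.Theory Num.Theory.
Import numFieldNormedType.Exports.

Local Open Scope classical_set_scope.
Local Open Scope ring_scope.

(** Call [rho = mu / c * sum_j (j + 1) lambda_j] the expected claim amount per
unit of premium.  The surplus is first watched on a time grid of step [h] only.
There it is a random walk with independent steps [xi = c h - Y], where [Y] is the
claim amount of one grid interval: [xi] never exceeds [c h], it equals [c h]
when no claim arrives, and it has mean [c h (1 - rho)].

For a random walk whose steps have mean [e >= 0] and are at most [b], the
probability [v] of never becoming negative satisfies
[e <= b v] and [Pr(xi = b) b v <= e].  Let [g_n x] be the probability of
staying nonnegative for [n] steps from capital [x]; it satisfies
[g_(n+1) x = E (g_n (x + xi))] for [x >= 0].  Its primitive [G_n] vanishing on
the negatives satisfies [G_(n+1) x = E (G_n (x + xi)) - E (G_n xi)], again for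
[x >= 0], so that [E (G_n xi)] can be read off at any height [x].  At large heights [G_n] has
slope close to one for [n] fixed, which gives [e <= E (G_n xi)], whereas the
limit [G] of [G_n] has slope at most one, which gives [E (G xi) <= e].  Since
[b] is the largest step, [E (G_n xi)] is at most [b E (g_n xi) = b g_(n+1) 0],
and the steps equal to [b] alone contribute at least [Pr(xi = b) b g 0] to
[E (G xi)], where [g] is the limit of [g_n].  These are
[mean_le_survival] and [ultimate_survival_le_mean].

For the grid of step [h] this squeezes the survival probability between
[1 - rho] and [(1 - rho) exp (Lambda h)] with [Lambda = sum_j lambda_j]
([grid_survives_bounds]), because [Pr(Y = 0)] is at least the probability
[exp (- Lambda h)] that the counting process has no jump.  The grids of step
[2 ^ - m] are nested and the paths are right-continuous, so survival in
continuous time is the decreasing intersection of the grid survival events,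
and its probability is [1 - rho] ([survives_probability]).

Two facts make the surplus on the grid a random walk, although one interval
consumes a random number of claims.  Given the history of the first [s] claims
the next [n] ones have a fresh sum distributed like that of the first [n]
([block_independent]), and the numbers of claims in successive intervals are
independent of each other and of all claim sizes; the survival recursion
follows by conditioning on the number of claims in the next interval
([solvent_law]).  The mean of [Y] comes from applying Wald's identity twice,
to the claims and to the jumps ([compound_mean]). *)

(** * Integration against a probability *)

Lemma measure_setI_full {d : measure_display} {T : measurableType d}
    {R : realType} (P : probability T R) (A F : set T) :
  measurable A -> measurable F -> P (~` F) = 0%E -> P (A `&` F) = P A.
Proof.
move=> mA mF F0; rewrite [RHS](measureDI P mA mF) [X in (X + _)%E](_ : _ = 0%E).
  by rewrite add0e.
have mAF := measurableD mA mF; have mFC := measurableC mF.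
by apply: (@subset_measure0 _ _ _ P _ (~` F)) => // w [].
Qed.

Lemma ae_eq_measure {d : measure_display} {T : measurableType d}
    {R : realType} (P : probability T R) (A B : set T) :
  measurable A -> measurable B -> {ae P, forall w, A w <-> B w} -> P A = P B.
Proof.
move=> mA mB [N [mN N0 subN]].
have mNC := measurableC mN.
rewrite -(measure_setI_full mA mNC) ?setCK// -(measure_setI_full mB mNC) ?setCK//.
congr (P _); apply/seteqP; split => w [Xw Nw]; split => //;
  have /contrapT[h1 h2] : ~ ~ (A w <-> B w) by move=> nAB; exact/Nw/subN.
- exact: h1.
- exact: h2.
Qed.

Section bounded_integrable.
Context {d : measure_display} {T : measurableType d} {R : realType}.
Variable P : probability T R.

Lemma bounded_integrable (f : T -> R) (C : R) :
  measurable_fun setT f -> (forall w, `|f w| <= C) ->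
  P.-integrable setT (EFin \o f).
Proof.
move=> mf fC; apply: (@le_integrable _ _ _ _ _ measurableT _ (EFin \o cst C)).
- exact/measurable_EFinP.
- by move=> w _ /=; rewrite lee_fin (le_trans (fC w))// ler_norm.
- exact: finite_measure_integrable_cst.
Qed.

Lemma Rintegral_dominated_cvg (f_ : nat -> T -> R) (f g : T -> R) :
  (forall n, measurable_fun setT (f_ n)) ->
  (forall w, f_ n w @[n --> \oo] --> f w) ->
  P.-integrable setT (EFin \o g) ->
  (forall n w, `|f_ n w| <= g w) ->
  \int[P]_w f_ n w @[n --> \oo] --> \int[P]_w f w.
Proof.
move=> mf cf ig fg.
have mlim : measurable_fun setT f.
  by apply: (measurable_fun_cvg mf) => w _; exact: cf.
have flim w : `|f w| <= g w.
  apply: (@cvgr_to_le _ \oo _ _ (fun n => `|f_ n w|)); first exact: cvg_norm (cf w).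
  by apply: nearW => n; exact: fg.
have if_ : P.-integrable setT (EFin \o f).
  apply: (le_integrable measurableT _ _ ig); first exact/measurable_EFinP.
  by move=> w _ /=; rewrite lee_fin (le_trans (flim w))// ler_norm.
apply: fine_cvg; rewrite fineK; last exact: integrable_fin_num.
apply: (@dominated_cvg _ _ _ _ _ measurableT _ _ (EFin \o g)) => //.
- by move=> n; exact/measurable_EFinP.
- by move=> w _; apply: cvg_EFin; [exact: nearW|exact: cf].
- by move=> n w _ /=; rewrite lee_fin.
Qed.

End bounded_integrable.

(** * Random walks with bounded upward steps *)

Section random_walk.
Context {d : measure_display} {T : measurableType d} {R : realType}.
Variables (P : probability T R) (xi : T -> R) (b : R).
Hypothesis b_gt0 : 0 < b.
Hypothesis xi_int : P.-integrable setT (EFin \o xi).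
Hypothesis xi_le : forall w, xi w <= b.

(** For steps distributed like [xi], [survival n x] is the probability that the
    walk started at [x] is nonnegative at times [0, ..., n].  The recursion on
    the first step avoids building the walk on a product space. *)
Fixpoint survival (n : nat) (x : R) : R :=
  if n is m.+1 then
    if 0 <= x then \int[P]_w survival m (x + xi w) else 0
  else if 0 <= x then 1 else 0.

(** [reserve n x] is [E (max (x + m_n) 0)], where [m_n] is the minimum of the
    first [n] partial sums of the walk (the empty one included); equivalently it
    is the primitive of [survival n] vanishing on the negatives.  Integrating
    the recursion of [survival] gives a recursion that involves neither [m_n]
    nor an integral over [x]. *)
Fixpoint reserve (n : nat) (x : R) : R :=
  if n is m.+1 then
    if 0 <= x then \int[P]_w (reserve m (x + xi w) - reserve m (xi w)) else 0
  else Num.max x 0.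

Let mxi : measurable_fun setT xi.
Proof. by move/measurable_int : xi_int => /measurable_EFinP. Qed.

Let mxD x : measurable_fun setT (fun w => x + xi w).
Proof. exact: measurable_funD. Qed.

Let Rint_cst (r : R) : \int[P]_w r = r.
Proof. by rewrite Rintegral_cst//= probability_setT mulr1. Qed.

Let int_cst (r : R) : P.-integrable setT (EFin \o cst r).
Proof. exact: finite_measure_integrable_cst. Qed.

Lemma survival_lt0 n x : x < 0 -> survival n x = 0.
Proof. by case: n => [|n] x0 /=; rewrite leNgt x0. Qed.

(** Bounds and monotonicity go through one induction: monotonicity at rank [n]
    is what makes [survival n (x + xi w)] measurable in [w], and boundedness is
    what makes it integrable. *)
Lemma survival_bounds_homo n :
  (forall x, 0 <= survival n x <= 1) /\ {homo survival n : x y / x <= y}.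
Proof.
elim: n => [|n [gb gm]].
  split=> [x|x y xy] /=; first by case: (0 <= x); rewrite ?lexx ?ler01.
  by case: (lerP 0 x) => [/le_trans/(_ xy) ->//|_]; case: (0 <= y).
have mg x : measurable_fun setT (fun w => survival n (x + xi w)).
  by apply: measurableT_comp => //; exact: nondecreasing_measurable.
have ig x : P.-integrable setT (EFin \o (fun w => survival n (x + xi w))).
  apply: (@bounded_integrable _ _ _ _ _ 1) => // w.
  by rewrite ger0_norm; case/andP: (gb (x + xi w)).
have gb' x : 0 <= survival n.+1 x <= 1.
  rewrite /=; case: ifP => _; last by rewrite lexx ler01.
  apply/andP; split.
    by apply: Rintegral_ge0 => w _; case/andP: (gb (x + xi w)).
  rewrite -[leRHS](Rint_cst 1); apply: le_Rintegral => //; first exact: int_cst.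
  by move=> w _; case/andP: (gb (x + xi w)).
split=> // x y xy.
have [x0|x0] := ltP x 0.
  by rewrite survival_lt0//; case/andP: (gb' y).
rewrite /= x0 (le_trans x0 xy); apply: le_Rintegral => // w _.
by apply: gm; rewrite lerD2r.
Qed.

Lemma survival_ge0 n x : 0 <= survival n x.
Proof. by case/andP: ((survival_bounds_homo n).1 x). Qed.

Lemma survival_le1 n x : survival n x <= 1.
Proof. by case/andP: ((survival_bounds_homo n).1 x). Qed.

Lemma survival_homo n : {homo survival n : x y / x <= y}.
Proof. exact: (survival_bounds_homo n).2. Qed.

Lemma measurable_survival n : measurable_fun setT (survival n).
Proof. by apply: nondecreasing_measurable => //; exact: survival_homo. Qed.

Lemma integrable_survival n x :
  P.-integrable setT (EFin \o (fun w => survival n (x + xi w))).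
Proof.
apply: (@bounded_integrable _ _ _ _ _ 1).
  by apply: (measurableT_comp (measurable_survival n)); exact: mxD.
by move=> w; rewrite ger0_norm ?survival_ge0 ?survival_le1.
Qed.

Lemma survivalS n x : 0 <= x ->
  survival n.+1 x = \int[P]_w survival n (x + xi w).
Proof. by move=> x0 /=; rewrite x0. Qed.

Lemma survivalS_le n x : survival n.+1 x <= survival n x.
Proof.
elim: n x => [|n IH] x.
  have [x0|x0] := ltP x 0; first by rewrite !survival_lt0.
  by rewrite [leRHS]/= x0 survival_le1.
have [x0|x0] := ltP x 0; first by rewrite !survival_lt0.
rewrite !survivalS//; apply: le_Rintegral => //.
- exact: integrable_survival.
- exact: integrable_survival.
Qed.

Lemma reserve_le0 n x : x <= 0 -> reserve n x = 0.
Proof.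
case: n => [|n] /=; first by move=> x0; rewrite max_r.
rewrite le_eqVlt => /orP[/eqP ->|x0]; last by rewrite leNgt x0.
by rewrite lexx; under eq_Rintegral do rewrite add0r subrr; rewrite Rint_cst.
Qed.

(** The difference quotients of a primitive of [survival n] lie in [0, 1].  As
    for [survival], monotonicity at one rank yields measurability at the
    next. *)
Lemma reserve_increment n x y : x <= y ->
  0 <= reserve n y - reserve n x <= y - x.
Proof.
elim: n x y => [|n IH] x y xy.
  rewrite /= !maxEle; case: ifPn; case: ifPn; lra.
have mr : measurable_fun setT (reserve n).
  apply: nondecreasing_measurable => // u v /IH /andP[+ _].
  by rewrite subr_ge0.
have ir u : P.-integrable setT
    (EFin \o (fun w => reserve n (u + xi w) - reserve n (xi w))).
  apply: (@bounded_integrable _ _ _ _ _ `|u|).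
    by apply: measurable_funB; exact: measurableT_comp.
  move=> w; have [u0|u0] := leP 0 u.
    have /IH/andP[h1 h2] : xi w <= u + xi w by rewrite lerDr.
    by rewrite !ger0_norm//; move: h2; rewrite addrK.
  have /IH/andP[h1 h2] : u + xi w <= xi w by rewrite gerDr ltW.
  rewrite distrC (ltr0_norm u0) ger0_norm//; lra.
have pos u v : 0 <= u -> u <= v ->
    0 <= reserve n.+1 v - reserve n.+1 u <= v - u.
  move=> u0 uv.
  have -> : reserve n.+1 v - reserve n.+1 u =
      \int[P]_w (reserve n (v + xi w) - reserve n (u + xi w)).
    rewrite /= u0 (le_trans u0 uv) -RintegralB//.
    by apply: eq_Rintegral => w _; lra.
  have h w := IH (u + xi w) (v + xi w).
  have i2 : P.-integrable setT
    (EFin \o (fun w => reserve n (v + xi w) - reserve n (u + xi w))).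
    apply: (@bounded_integrable _ _ _ _ _ (v - u)).
      by apply: measurable_funB; exact: measurableT_comp.
    move=> w; have /andP[h1 h2] := h w (lerD uv (lexx (xi w))).
    rewrite ger0_norm//; lra.
  apply/andP; split.
    by apply: Rintegral_ge0 => w _; case/andP: (h w (lerD uv (lexx (xi w)))).
  rewrite -[leRHS]Rint_cst; apply: le_Rintegral => //; first exact: int_cst.
  move=> w _; have /andP[h1 h2] := h w (lerD uv (lexx (xi w))); lra.
have [x0|x0] := leP x 0; last exact: pos (ltW x0) xy.
rewrite (reserve_le0 _ x0).
have [y0|y0] := leP y 0; first by rewrite reserve_le0//; lra.
have := pos 0 y (lexx _) (ltW y0); rewrite (reserve_le0 _ (lexx 0)); lra.
Qed.

Lemma reserve_homo n : {homo reserve n : x y / x <= y}.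
Proof. by move=> x y /(reserve_increment n)/andP[+ _]; rewrite subr_ge0. Qed.

Lemma reserve_ge0 n x : 0 <= reserve n x.
Proof.
have [x0|x0] := leP x 0; first by rewrite reserve_le0.
by rewrite -(reserve_le0 n (lexx 0)) reserve_homo// ltW.
Qed.

Lemma reserve_lipschitz n x y : `|reserve n y - reserve n x| <= `|y - x|.
Proof.
wlog xy : x y / x <= y.
  move=> H; have [|/ltW] := leP x y; first exact: H.
  by move=> /H; rewrite distrC [leRHS]distrC.
have /andP[h1 h2] := reserve_increment n xy.
by rewrite !ger0_norm// subr_ge0.
Qed.

Lemma measurable_reserve n : measurable_fun setT (reserve n).
Proof. by apply: nondecreasing_measurable => //; exact: reserve_homo. Qed.

Lemma integrable_reserve n x :
  P.-integrable setT (EFin \o (fun w => reserve n (x + xi w))).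
Proof.
apply: (@bounded_integrable _ _ _ _ _ (reserve n (x + b))).
  by apply: (measurableT_comp (measurable_reserve n)); exact: mxD.
by move=> w; rewrite ger0_norm ?reserve_ge0// reserve_homo// lerD2l.
Qed.

Lemma integrable_reserve0 n :
  P.-integrable setT (EFin \o (fun w => reserve n (xi w))).
Proof.
have := integrable_reserve n 0; apply: eq_integrable => // w _ /=.
by rewrite add0r.
Qed.

Let integrable_reserveB n u v : P.-integrable setT
  (EFin \o (fun w => reserve n (v + xi w) - reserve n (u + xi w))).
Proof.
exact: (integrableB _ (integrable_reserve n v) (integrable_reserve n u)).
Qed.

Let Rint_reserveB n u v :
  \int[P]_w reserve n (v + xi w) - \int[P]_w reserve n (u + xi w) =
  \int[P]_w (reserve n (v + xi w) - reserve n (u + xi w)).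
Proof. by rewrite RintegralB//; exact: integrable_reserve. Qed.

Lemma reserveS n x : 0 <= x ->
  reserve n.+1 x = \int[P]_w reserve n (x + xi w) - \int[P]_w reserve n (xi w).
Proof.
move=> x0; rewrite /= x0 RintegralB//; first exact: integrable_reserve.
exact: integrable_reserve0.
Qed.

(** The precise sense in which [survival] is the derivative of [reserve]: a
    single inequality contains both the lower bound on the increments ([x <= y])
    and the upper bound ([y <= x]), and it makes [reserve] convex.  It is
    preserved by expectation. *)
Lemma reserve_subgradient n x y :
  survival n x * (y - x) <= reserve n y - reserve n x.
Proof.
elim: n x y => [|n IH] x y.
  rewrite /= !maxEle; case: (leP 0 x); case: ifPn; case: ifPn;
    rewrite ?mul1r ?mul0r ?mulr1n ?mulr0n; lra.
have pos u v : 0 <= u -> 0 <= v ->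
    survival n.+1 u * (v - u) <= reserve n.+1 v - reserve n.+1 u.
  move=> u0 v0.
  have -> : reserve n.+1 v - reserve n.+1 u =
      \int[P]_w reserve n (v + xi w) - \int[P]_w reserve n (u + xi w).
    by rewrite !reserveS//; lra.
  rewrite Rint_reserveB /= u0 -RintegralZr; [|by []|exact: integrable_survival].
  apply: le_Rintegral => //.
  - exact: (integrableZr _ _ (integrable_survival n u)).
  - move=> w _; apply: le_trans (IH _ _).
    by rewrite le_eqVlt; apply/orP; left; apply/eqP; congr (_ * _); lra.
have [x0|x0] := ltP x 0.
  rewrite survival_lt0// mul0r (reserve_le0 _ (ltW x0)) subr0.
  exact: reserve_ge0.
have [y0|y0] := leP 0 y; first exact: pos.
have := pos x 0 x0 (lexx _).
rewrite (reserve_le0 n.+1 (ltW y0)) (reserve_le0 n.+1 (lexx 0)).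
apply: le_trans; rewrite ler_wpM2l ?survival_ge0//; lra.
Qed.

(** Longer horizons have smaller survival probabilities, hence smaller increments
    of the primitive. *)
Lemma reserveS_increment n x y : x <= y ->
  reserve n.+1 y - reserve n.+1 x <= reserve n y - reserve n x.
Proof.
elim: n x y => [|n IH] x y xy.
  have [x0|x0] := leP x 0; last first.
    have /andP[_ ] := reserve_increment 1 xy => /le_trans; apply => /=.
    rewrite !max_l ?(ltW x0)//; lra.
  rewrite !(reserve_le0 _ x0).
  have [y0|y0] := leP y 0; first by rewrite !(reserve_le0 _ y0).
  have /andP[_] := reserve_increment 1 (ltW y0).
  by rewrite (reserve_le0 _ (lexx 0)) !subr0 => /le_trans; apply; rewrite le_max lexx.
have pos u v : 0 <= u -> u <= v ->
    reserve n.+2 v - reserve n.+2 u <= reserve n.+1 v - reserve n.+1 u.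
  move=> u0 uv; have v0 := le_trans u0 uv.
  rewrite !(reserveS _ u0) !(reserveS _ v0).
  have subD (r s t : R) : (r - t) - (s - t) = r - s by lra.
  rewrite !subD !Rint_reserveB; apply: le_Rintegral => //.
    by move=> w _; apply: IH; rewrite lerD2r.
have [x0|x0] := leP x 0; last exact: pos (ltW x0) xy.
rewrite !(reserve_le0 _ x0).
have [y0|y0] := leP y 0; first by rewrite !(reserve_le0 _ y0).
by have := pos 0 y (lexx _) (ltW y0); rewrite !(reserve_le0 _ (lexx 0)).
Qed.

Lemma reserveS_le n x : reserve n.+1 x <= reserve n x.
Proof.
have [x0|x0] := leP x 0; first by rewrite !reserve_le0.
by have := reserveS_increment n (ltW x0); rewrite !(reserve_le0 _ (lexx 0)) !subr0.
Qed.

Let e := \int[P]_w xi w.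

Lemma Rint_deficit n x :
  \int[P]_w (x + xi w - reserve n (x + xi w)) =
  x + e - \int[P]_w reserve n (x + xi w).
Proof.
have iD := integrableD measurableT (int_cst x) xi_int.
rewrite (RintegralB measurableT iD (integrable_reserve n x)).
by rewrite (RintegralD measurableT (int_cst x) xi_int) Rint_cst.
Qed.

Lemma integrable_deficit n x :
  P.-integrable setT (EFin \o (fun w => x + xi w - reserve n (x + xi w))).
Proof.
exact: (integrableB _ (integrableD _ (int_cst x) xi_int) (integrable_reserve n x)).
Qed.

(** [x - reserve n x] increases to the mean of [- m_n], finite for each [n] but
    in general not uniformly in [n]. *)
Lemma deficit_bounded n : exists C, forall x, x - reserve n x <= C.
Proof.
elim: n => [|n [C HC]].
  by exists 0 => x; rewrite subr_le0 /= le_max lexx.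
exists (Num.max 0 (C - e + \int[P]_w reserve n (xi w))) => x.
rewrite le_max; have [x0|x0] := ltP x 0.
  by apply/orP; left; rewrite (reserve_le0 _ (ltW x0)); lra.
apply/orP; right; rewrite reserveS//.
suff : \int[P]_w (x + xi w - reserve n (x + xi w)) <= C.
  by rewrite Rint_deficit; lra.
rewrite -[leRHS]Rint_cst; apply: le_Rintegral => //.
- exact: integrable_deficit.
- exact: int_cst.
Qed.

(** By the recursion at height [x], the difference between the mean step and
    the mean of [reserve n xi] is at most the increment over [[x, x + b]] of the
    function [y - reserve n y].  That function is nondecreasing and bounded, so
    its increments cannot stay above a positive number. *)
Lemma mean_le_reserve n : e <= \int[P]_w reserve n (xi w).
Proof.
rewrite leNgt; apply/negP => lt_e.
pose D := e - \int[P]_w reserve n (xi w).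
have D0 : 0 < D by rewrite subr_gt0.
pose kappa x := x - reserve n x.
have kappa_homo x y : x <= y -> kappa x <= kappa y.
  by move=> /(reserve_increment n)/andP[_]; rewrite /kappa; lra.
have step x : 0 <= x -> kappa x + D <= kappa (x + b).
  move=> x0; have := reserveS_le n x; rewrite reserveS//.
  have : \int[P]_w (x + xi w - reserve n (x + xi w)) <= kappa (x + b).
    rewrite -[leRHS]Rint_cst; apply: le_Rintegral => //.
    - exact: integrable_deficit.
    - exact: int_cst.
    - by move=> w _; apply: kappa_homo; rewrite lerD2l.
  by rewrite Rint_deficit /kappa /D; lra.
have grow i : D *+ i <= kappa (b *+ i).
  elim: i => [|i IH]; first by rewrite !mulr0n /kappa reserve_le0// subr0.
  rewrite !mulrSr (le_trans _ (step _ _))//; first by rewrite lerD2r.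
  by rewrite mulrn_wge0 ?ltW.
(* The bound at [b *+ i] with [i > C / D] contradicts boundedness. *)
have [C HC] := deficit_bounded n.
have C0 : 0 <= C by have := HC 0; rewrite reserve_le0// subr0.
have := grow (Num.truncn (C / D)).+1; apply/negP; rewrite -ltNge.
apply: le_lt_trans (HC _) _.
rewrite -mulr_natr mulrC -ltr_pdivrMr//.
exact: truncnS_gt.
Qed.

(** Convexity and [reserve n 0 = 0] bound [reserve n y] by [y * survival n y],
    and a step is at most [b]. *)
Lemma mean_le_survival n : e <= b * survival n.+1 0.
Proof.
apply: (le_trans (mean_le_reserve n)).
rewrite /= lexx -RintegralZl//; last exact: integrable_survival.
under [leRHS]eq_Rintegral do rewrite add0r.
apply: le_Rintegral => //.
- exact: integrable_reserve0.
- have := integrableZl measurableT b (integrable_survival n 0).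
  by apply: eq_integrable => // w _ /=; rewrite add0r.
- move=> w _; have := reserve_subgradient n (xi w) 0.
  rewrite (reserve_le0 _ (lexx 0)) !sub0r mulrN lerN2 => /le_trans; apply.
  by rewrite mulrC ler_wpM2r ?survival_ge0.
Qed.

Definition ultimate_survival (x : R) : R := limn (survival ^~ x).

Definition ultimate_reserve (x : R) : R := limn (reserve ^~ x).

Lemma cvg_survival x : survival n x @[n --> \oo] --> ultimate_survival x.
Proof.
apply: nonincreasing_is_cvgn; last by exists 0 => _ [n _ <-]; exact: survival_ge0.
by apply/nonincreasing_seqP => n; exact: survivalS_le.
Qed.
Arguments cvg_survival : clear implicits.

Lemma cvg_reserve x : reserve n x @[n --> \oo] --> ultimate_reserve x.
Proof.
apply: nonincreasing_is_cvgn; last by exists 0 => _ [n _ <-]; exact: reserve_ge0.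
by apply/nonincreasing_seqP => n; exact: reserveS_le.
Qed.
Arguments cvg_reserve : clear implicits.

Lemma ultimate_survival_homo : {homo ultimate_survival : x y / x <= y}.
Proof.
move=> x y xy; apply: (ler_cvg_to (cvg_survival x) (cvg_survival y)).
by apply: nearW => n; exact: survival_homo.
Qed.

Lemma ultimate_survival_ge0 x : 0 <= ultimate_survival x.
Proof.
apply: (ler_cvg_to (cvg_cst 0) (cvg_survival x)).
by apply: nearW => n; exact: survival_ge0.
Qed.

Lemma ultimate_survival_le1 x : ultimate_survival x <= 1.
Proof.
apply: (cvgr_to_le (cvg_survival x)).
by apply: nearW => n; exact: survival_le1.
Qed.

Lemma ultimate_reserve_homo : {homo ultimate_reserve : x y / x <= y}.
Proof.
move=> x y xy; apply: (ler_cvg_to (cvg_reserve x) (cvg_reserve y)).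
by apply: nearW => n; exact: reserve_homo.
Qed.

Lemma ultimate_reserve_ge0 x : 0 <= ultimate_reserve x.
Proof.
apply: (ler_cvg_to (cvg_cst 0) (cvg_reserve x)).
by apply: nearW => n; exact: reserve_ge0.
Qed.

Lemma ultimate_reserve0 : ultimate_reserve 0 = 0.
Proof.
rewrite /ultimate_reserve; under eq_fun do rewrite reserve_le0//.
exact: lim_cst.
Qed.

Lemma ultimate_reserve_lipschitz x y :
  `|ultimate_reserve y - ultimate_reserve x| <= `|y - x|.
Proof.
apply: (@cvgr_to_le _ \oo _ _ (fun n => `|reserve n y - reserve n x|)).
  by apply: cvg_norm; apply: cvgB; exact: cvg_reserve.
by apply: nearW => n; exact: reserve_lipschitz.
Qed.

Lemma ultimate_reserve_subgradient x y :
  ultimate_survival x * (y - x) <= ultimate_reserve y - ultimate_reserve x.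
Proof.
apply: (@ler_cvg_to _ \oo _ _ (fun n => survival n x * (y - x))
  (fun n => reserve n y - reserve n x)).
- by apply: cvgMl; exact: cvg_survival.
- by apply: cvgB; exact: cvg_reserve.
- by apply: nearW => n; exact: reserve_subgradient.
Qed.

Let mU x : measurable_fun setT (fun w => ultimate_reserve (x + xi w)).
Proof.
apply: (@measurableT_comp _ _ _ _ _ _ ultimate_reserve) => //.
by apply: nondecreasing_measurable => //; exact: ultimate_reserve_homo.
Qed.

Let iU x : P.-integrable setT (EFin \o (fun w => ultimate_reserve (x + xi w))).
Proof.
apply: (@bounded_integrable _ _ _ _ _ (ultimate_reserve (x + b))) => // w.
by rewrite ger0_norm ?ultimate_reserve_ge0// ultimate_reserve_homo// lerD2l.
Qed.

Lemma ultimate_reserveE x : 0 <= x -> ultimate_reserve x =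
  \int[P]_w ultimate_reserve (x + xi w) - \int[P]_w ultimate_reserve (xi w).
Proof.
move=> x0.
have cI y : \int[P]_w reserve n (y + xi w) @[n --> \oo] -->
    \int[P]_w ultimate_reserve (y + xi w).
  apply: (@Rintegral_dominated_cvg _ _ _ _ _ _ (cst (Num.max (y + b) 0))) => //.
  - by move=> n; apply: (measurableT_comp (measurable_reserve n)); exact: mxD.
  - by move=> w; exact: cvg_reserve.
  - move=> n w; rewrite ger0_norm ?reserve_ge0//=.
    apply: (@le_trans _ _ (reserve 0 (y + b))) => //.
    apply: (@le_trans _ _ (reserve n (y + b))).
      by rewrite reserve_homo// lerD2l.
    by elim: n => // n; apply: le_trans; exact: reserveS_le.
have cI0 : \int[P]_w reserve n (xi w) @[n --> \oo] -->
    \int[P]_w ultimate_reserve (xi w).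
  by have := cI 0; under eq_fun do under eq_Rintegral do rewrite add0r;
    under [X in _ --> X]eq_Rintegral do rewrite add0r.
have c1 : reserve n.+1 x @[n --> \oo] -->
    \int[P]_w ultimate_reserve (x + xi w) - \int[P]_w ultimate_reserve (xi w).
  under eq_fun do rewrite reserveS//.
  by apply: cvgB.
have c2 := cvg_reserve x; rewrite -cvg_shiftS in c2.
exact: (cvg_unique _ c2 c1).
Qed.

(** The slope of the convex function [ultimate_reserve] tends to the supremum of
    [ultimate_survival]; nothing forces this supremum to be one here (it is zero
    for centred nondegenerate steps). *)
Lemma cvg_ultimate_reserve_increment y :
  ultimate_reserve (n%:R + y) - ultimate_reserve n%:R @[n --> \oo] -->
  sup (range ultimate_survival) * y.
Proof.
have cg : ultimate_survival x @[x --> +oo] --> sup (range ultimate_survival).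
  apply: nondecreasing_cvgr; first exact: ultimate_survival_homo.
  by exists 1 => _ [x _ <-]; exact: ultimate_survival_le1.
have cn : ultimate_survival n%:R @[n --> \oo] --> sup (range ultimate_survival).
  by apply: cvg_comp cg; exact: cvgr_idn.
have cny : ultimate_survival (n%:R + y) @[n --> \oo] -->
    sup (range ultimate_survival).
  apply: (@cvg_comp _ _ _ (fun n : nat => n%:R + y) ultimate_survival) cg.
  apply/cvgryPge => B; have /cvgryPge/(_ (B - y)) := @cvgr_idn R.
  by apply: filterS => n; rewrite lerBlDr.
apply: (@squeeze_cvgr _ \oo _ _ (fun n => ultimate_survival n%:R * y)
  (fun n => ultimate_survival (n%:R + y) * y)).
- apply: nearW => n; apply/andP; split.
    by have := ultimate_reserve_subgradient n%:R (n%:R + y); rewrite addrC addKr.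
  have := ultimate_reserve_subgradient (n%:R + y) n%:R.
  by rewrite opprD addrA subrr add0r mulrN; lra.
- exact: cvgMl.
- exact: cvgMl.
Qed.

(** The recursion in the limit makes [E (G (x + xi)) - G x] independent of [x >= 0];
    its value is obtained by letting [x] tend to infinity, with dominated
    convergence, [G] being 1-Lipschitz. *)
Lemma mean_ultimate_reserve :
  \int[P]_w ultimate_reserve (xi w) = sup (range ultimate_survival) * e.
Proof.
rewrite -RintegralZl//.
have : \int[P]_w (ultimate_reserve (n%:R + xi w) - ultimate_reserve n%:R)
    @[n --> \oo] --> \int[P]_w (sup (range ultimate_survival) * xi w).
  apply: (@Rintegral_dominated_cvg _ _ _ _ _ _ (fun w => `|xi w|)) => //.
  - by move=> n; apply: measurable_funB.
  - by move=> w; exact: cvg_ultimate_reserve_increment.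
  - exact: integrable_norm.
  - move=> n w; apply: le_trans (ultimate_reserve_lipschitz _ _) _.
    by rewrite addrC addKr.
apply: cvg_unique => //.
rewrite (_ : (fun n => _) = cst (\int[P]_w ultimate_reserve (xi w))).
  exact: cvg_cst.
apply/funext => n /=.
rewrite (RintegralB measurableT (iU n%:R) (int_cst _)) Rint_cst.
by rewrite [X in _ - X]ultimate_reserveE//; lra.
Qed.

(** A step equal to [b] contributes at least [b * ultimate_survival 0] to the mean
    of [ultimate_reserve xi], by convexity at [0]. *)
Lemma ultimate_survival_le_mean : 0 <= e ->
  fine (P [set w | xi w = b]) * (b * ultimate_survival 0) <= e.
Proof.
move=> e0; pose A := [set w | xi w = b].
have mA : measurable A.
  by have := mxi measurableT (measurable_set1 b); rewrite setTI.
apply: (@le_trans _ _ (\int[P]_w ultimate_reserve (xi w))); last first.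
  rewrite mean_ultimate_reserve -[leRHS]mul1r ler_wpM2r//.
  apply: ge_sup; first by exists (ultimate_survival 0), 0.
  by move=> _ [x _ <-]; exact: ultimate_survival_le1.
have iA : P.-integrable setT (EFin \o \1_A) by exact: integrable_indic.
have -> : fine (P A) = \int[P]_w \1_A w.
  by rewrite /Rintegral integral_indic// setIT.
rewrite -RintegralZr//; apply: le_Rintegral => //.
- exact: (integrableZr _ _ iA).
- by have := iU 0; apply: eq_integrable => // w _ /=; rewrite add0r.
- move=> w _; rewrite indicE; case: (boolP (w \in A)) => [|_].
    rewrite inE => ->; rewrite mul1r.
    have := ultimate_reserve_subgradient 0 b.
    by rewrite ultimate_reserve0 !subr0 mulrC.
  by rewrite mul0r ultimate_reserve_ge0.
Qed.

End random_walk.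

(** * Independence and generated sigma-algebras *)

Section independence_tools.
Context {d : measure_display} {T : measurableType d} {R : realType}.
Variable P : probability T R.
Local Open Scope ereal_scope.

Lemma ge0_integral_mrestr (D : set T) (mD : measurable D) (f : T -> \bar R) :
  measurable_fun setT f -> (forall w, 0 <= f w) ->
  \int[mrestr P mD]_w f w = \int[P]_(w in D) f w.
Proof.
move=> mf f0; rewrite (@ge0_negligible_integral _ _ _ _ _ (~` D))//=.
- rewrite setTD setCK; apply: eq_measure_integral => A mA AD /=.
  by rewrite /mrestr (setIidl AD).
- exact: measurableC.
- by rewrite /mrestr setICl measure0.
Qed.

(** [V'] has the law of [V]: this form also replaces a variable by a copy of it
    that is easier to handle. *)
Lemma integral_indep_event d2 (T2 : measurableType d2) (H : set T)
    (V V' : T -> T2) (phi : T2 -> \bar R) :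
  measurable H -> measurable_fun setT V -> measurable_fun setT V' ->
  (forall B, measurable B -> P (H `&` V @^-1` B) = P H * P (V' @^-1` B)) ->
  measurable_fun setT phi -> (forall y, 0 <= phi y) ->
  \int[P]_(w in H) phi (V w) = P H * \int[P]_w phi (V' w).
Proof.
move=> mH mV mV' HV mphi phi0.
pose q := fine (P H).
have q0 : (0 <= q)%R by exact: fine_ge0.
have PHq : P H = (NngNum q0)%:num%:E.
  by rewrite /= /q fineK// fin_num_measure.
rewrite -(ge0_integral_mrestr mH); [|exact: measurableT_comp|by []].
rewrite -(ge0_integral_pushforward mV (mrestr P mH) measurableT mphi)//.
rewrite -[in RHS](ge0_integral_pushforward mV' P measurableT mphi)//.
rewrite PHq -ge0_integral_mscale//.
apply: eq_measure_integral => B mB _ /=.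
by rewrite /pushforward /mrestr /mscale/= setIC HV// PHq.
Qed.

(** A variable [V] independent of [X] may be frozen and integrated separately:
    the hypothesis says that the law of the pair is the product of the law of
    [X] and the law of [V'], so this is Tonelli's theorem for that product. *)
Lemma integral_indep d1 d2 (T1 : measurableType d1) (T2 : measurableType d2)
    (X : T -> T1) (V V' : T -> T2) (f : T1 * T2 -> \bar R) :
  measurable_fun setT X -> measurable_fun setT V -> measurable_fun setT V' ->
  (forall A B, measurable A -> measurable B ->
    P (X @^-1` A `&` V @^-1` B) = P (X @^-1` A) * P (V' @^-1` B)) ->
  measurable_fun setT f -> (forall z, 0 <= f z) ->
  \int[P]_w f (X w, V w) = \int[P]_w \int[P]_w' f (X w, V' w').
Proof.
move=> mX mV mV' XV mf f0.
pose Xm := isMeasurableFun.Build _ _ _ _ _ mX.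
pose X' : {RV P >-> T1} := HB.pack X Xm.
pose Vm := isMeasurableFun.Build _ _ _ _ _ mV'.
pose W : {RV P >-> T2} := HB.pack V' Vm.
have mXV : measurable_fun setT (fun w => (X w, V w)) by exact: measurable_fun_pair.
transitivity (\int[pushforward P (fun w => (X w, V w))]_z f z).
  by rewrite (ge0_integral_pushforward mXV P measurableT mf).
transitivity (\int[distribution P X' \x distribution P W]_z f z).
  apply: eq_measure_integral => A mA _; apply/esym.
  by apply: (product_measure_unique (m1 := distribution P X')
    (m2 := distribution P W)) => // B C mB mC.
rewrite fubini_tonelli1//.
rewrite ge0_integral_distribution.
- apply: eq_integral => w _ /=; rewrite /fubini_F ge0_integral_distribution//=.
  exact: measurableT_comp.
- exact: measurable_fun_fubini_tonelli_F.
- by move=> x; apply: integral_ge0.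
Qed.

End independence_tools.

Section generated_sigma_algebras.
Context {d d1 : measure_display} {T : measurableType d}
  {T1 : measurableType d1}.

(** The sample space with the sigma-algebra generated by the [Y i], [i] in [D]:
    measurability with respect to that sub-sigma-algebra becomes measurability of
    a function on this type. *)
Definition history {I : Type} (D : set I) (Y : I -> T -> T1) :=
  g_sigma_algebraType (\bigcup_(i in D) preimage_set_system setT (Y i) measurable).

Lemma history_measurable {I : Type} (D : set I) (Y : I -> T -> T1) :
  (forall i, D i -> measurable_fun setT (Y i)) ->
  generated_sigma_algebra D Y `<=` measurable.
Proof.
move=> mY; apply: smallest_sub; first exact: sigma_algebra_measurable.
by move=> _ [i Di [B mB <-]]; exact: (mY i Di).
Qed.

Lemma sub_history {I : Type} (D D' : set I) (Y : I -> T -> T1) :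
  D `<=` D' -> generated_sigma_algebra D Y `<=` generated_sigma_algebra D' Y.
Proof.
move=> DD'; apply: sub_smallest2r; first exact: smallest_sigma_algebra.
by move=> _ [i Di [B mB <-]]; exists i; [exact: DD'|exists B].
Qed.

Lemma measurable_history {I : Type} (D : set I) (Y : I -> T -> T1) (i : I) :
  D i -> measurable_fun setT (Y i : history D Y -> T1).
Proof. by move=> Di _ B mB; apply: sub_sigma_algebra; exists i => //; exists B. Qed.

Lemma measurable_history_id {I : Type} (D : set I) (Y : I -> T -> T1) :
  (forall i, D i -> measurable_fun setT (Y i)) ->
  measurable_fun setT (id : T -> history D Y).
Proof.
by move=> mY _ A mA; rewrite setTI preimage_id; exact: (history_measurable mY).
Qed.

Lemma measurable_from_history {I : Type} (D : set I) (Y : I -> T -> T1)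
    d2 (T2 : measurableType d2) (f : T -> T2) :
  (forall i, D i -> measurable_fun setT (Y i)) ->
  measurable_fun setT (f : history D Y -> T2) -> measurable_fun setT f.
Proof.
by move=> mY mf _ B mB; apply: (history_measurable mY); exact: mf.
Qed.

(** Freezing, conditionally on a history: the integrand may depend on the whole
    history through its first argument, the domain being an event of that
    history. *)
Lemma integral_history_indep {R : realType} (P : probability T R) {I : Type}
    (D : set I) (Y : I -> T -> T1) d2 (T2 : measurableType d2)
    (V V' : T -> T2) (A : set T) (f : history D Y * T2 -> \bar R) :
  (forall i, D i -> measurable_fun setT (Y i)) ->
  measurable_fun setT V -> measurable_fun setT V' ->
  (forall B C, generated_sigma_algebra D Y B -> measurable C ->
    P (B `&` V @^-1` C) = P B * P (V' @^-1` C))%E ->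
  generated_sigma_algebra D Y A ->
  measurable_fun setT f -> (forall z, 0 <= f z)%E ->
  (\int[P]_(w in A) f (w, V w) = \int[P]_(w in A) \int[P]_w' f (w, V' w'))%E.
Proof.
move=> mY mV mV' VV' sA mf f0.
pose g (z : history D Y * T2) : \bar R := ((\1_A z.1)%:E * f z)%E.
have mg : measurable_fun setT g.
  apply: emeasurable_funM => //; apply/measurable_EFinP.
  apply: (@measurableT_comp _ _ _ _ _ _ (\1_A : history D Y -> R)).
    exact: measurable_indic.
  exact: measurable_fst.
have patch_g (u : T) (y : \bar R) :
    (if u \in A then y else 0)%E = ((\1_A u)%:E * y)%E.
  by rewrite indicE; case: (u \in A); rewrite ?mul1e ?mul0e.
rewrite [LHS]integral_mkcond [RHS]integral_mkcond.
transitivity (\int[P]_w g (w, V w))%E.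
  by apply: eq_integral => w _; rewrite patchE patch_g.
rewrite (@integral_indep _ _ _ P _ _ _ _ (id : T -> history D Y) V V' g)//.
- apply: eq_integral => w _; rewrite patchE patch_g -ge0_integralZl//.
  + apply: (@measurableT_comp _ _ _ _ _ _ f) => //.
    exact: (measurable_fun_pair (measurable_cst _) mV').
- exact: measurable_history_id.
- by move=> z; rewrite mule_ge0 ?lee_fin.
Qed.

Lemma preimage_history d2 (T2 : measurableType d2) {I : Type} (D : set I)
    (Y : I -> T -> T1) (f : T1 -> T2) :
  measurable_fun setT f ->
  generated_sigma_algebra D (fun i => f \o Y i) `<=`
  generated_sigma_algebra D Y.
Proof.
move=> mf; apply: smallest_sub; first exact: smallest_sigma_algebra.
move=> _ [i Di [B mB <-]]; apply: sub_sigma_algebra; exists i => //.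
by exists (f @^-1` B) => //; have := mf measurableT B mB; rewrite setTI.
Qed.

(** A pi-lambda argument.  The finite intersections of events [Y j \in C j] with
    [j] in [D] are closed under intersection and generate the history, and on them
    the equality is an instance of mutual independence because [i] is not in
    [D]. *)
Lemma independent_of_history {R : realType} (P : probability T R) {I : eqType}
    (Y : I -> T -> T1) (D : set I) (i : I) (A : set T) (B : set T1) :
  (forall j, measurable_fun setT (Y j)) -> mutually_independent P Y ->
  ~ D i -> generated_sigma_algebra D Y A -> measurable B ->
  P (A `&` Y i @^-1` B) = (P A * P (Y i @^-1` B))%E.
Proof.
move=> mY iY Di sA mB.
pose G := [set C | exists (s : seq I) (B : I -> set T1),
  [/\ uniq s, (forall j, j \in s -> D j), (forall j, measurable (B j)) &
      C = \bigcap_(j in [set` s]) Y j @^-1` B j]].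
have mYB j C : measurable C -> measurable (Y j @^-1` C).
  by move=> mC; rewrite -[_ @^-1` _]setTI; exact: mY.
have GT : G setT.
  exists [::], (fun=> setT); split => //.
  by rewrite set_nil bigcap_set0.
have Gm : G `<=` measurable.
  move=> _ [s [C [_ _ mC ->]]]; apply: fin_bigcap_measurable.
    exact: finite_seq.
  by move=> j _; exact: mYB.
have GI : setI_closed G.
  move=> _ _ [s [C [us sD mC ->]]] [s' [C' [us' sD' mC' ->]]].
  exists (undup (s ++ s')), (fun j => (if j \in s then C j else setT) `&`
    (if j \in s' then C' j else setT)); split.
  - exact: undup_uniq.
  - by move=> j; rewrite mem_undup mem_cat => /orP[/sD|/sD'].
  - by move=> j; apply: measurableI; case: ifP.
  - apply/seteqP; split => [w [h h'] j _|w h]; first split.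
    + by case: ifPn => // js; exact: h.
    + by case: ifPn => // js; exact: h'.
    + split=> j /= js.
        have [|] := h j; first by rewrite /= mem_undup mem_cat js.
        by rewrite js.
      have [|_] := h j; first by rewrite /= mem_undup mem_cat js orbT.
      by rewrite js.
pose mV := mYB i B mB.
pose q := fine (P (Y i @^-1` B)).
have q0 : 0 <= q by exact: fine_ge0.
have qE : P (Y i @^-1` B) = (NngNum q0)%:num%:E.
  by rewrite /= /q fineK// fin_num_measure.
suff: mrestr P mV A = mscale (NngNum q0) P A.
  by rewrite /mrestr /mscale /= => ->; rewrite qE muleC.
apply: (@g_sigma_algebra_measure_unique _ _ _ G Gm (fun=> setT)) => //.
- by rewrite bigcup_const//; exists 0%N.
- move=> _ [s [C [us sD mC ->]]].
  rewrite /mrestr /mscale /=.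
  have iNs : i \notin s by apply/negP => /sD.
  have := iY (i :: s) (fun j => if j == i then B else C j).
  rewrite /= iNs us => /(_ isT) h.
  have {}h := h (fun j => ltac:(by case: ifP)).
  rewrite big_cons eqxx in h.
  have e1 : \bigcap_(j in [set` i :: s]) Y j @^-1` (if j == i then B else C j)
      = (\bigcap_(j in [set` s]) Y j @^-1` C j) `&` Y i @^-1` B.
    apply/seteqP; split => w.
      move=> H; split; last first.
        by have := H i; rewrite /= eqxx; apply; rewrite mem_head.
      move=> j /= js; have := H j; rewrite /= inE js orbT ifN; first exact.
      by apply: contraNneq iNs => <-.
    move=> [H HB] j /=; rewrite inE; case: eqVneq => [->//|_] /= js.
    exact: H.
  rewrite e1 in h.
  transitivity (P (Y i @^-1` B) * P (\bigcap_(j in [set` s]) Y j @^-1` C j))%E.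
    apply: (etrans h); congr (_ * _)%E; rewrite (iY s C us mC).
    rewrite big_seq [RHS]big_seq; apply: eq_bigr => j js.
    by rewrite ifN//; apply: contraNneq iNs => <-.
  by rewrite qE.
- move=> l; rewrite (le_lt_trans (probability_le1 _ _))// ?ltry//.
  exact: measurableI.
- move: sA; apply: sub_smallest2r; first exact: smallest_sigma_algebra.
  move=> _ [j Dj [C mC <-]]; exists [:: j], (fun=> C); split => //.
    by move=> k; rewrite inE => /eqP ->.
  by rewrite set_cons1 bigcap_set1 setTI.
Qed.

End generated_sigma_algebras.

(** * Sums of independent identically distributed claims *)

Section claims.
Context {d : measure_display} {T : measurableType d} {R : realType}.
Variables (P : probability T R) (Z : nat -> {RV P >-> R}).
Hypothesis Zind : mutually_independent P (fun j => Z j : T -> R).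
Hypothesis Zlaw : forall j (B : set R), measurable B ->
  P (Z j @^-1` B) = P (Z 0%N @^-1` B).

Definition total (s : nat) (w : T) : R := \sum_(j < s) Z j w.

Let Zf := fun j => Z j : T -> R.
Let before (s : nat) : set nat := [set j | (j < s)%N].
Let past (s : nat) := history (before s) Zf.

Let mZ j : measurable_fun setT (Zf j). Proof. exact: measurable_funPT. Qed.

Lemma total0 w : total 0 w = 0. Proof. by rewrite /total big_ord0. Qed.

Lemma totalS s w : total s.+1 w = total s w + Z s w.
Proof. by rewrite /total big_ord_recr. Qed.

Lemma measurable_total_past s n :
  (n <= s)%N -> measurable_fun setT (total n : past s -> R).
Proof.
elim: n => [|n IH] ns.
  by rewrite (_ : total 0 = cst 0)//; apply/funext => w; rewrite total0.
rewrite (_ : total n.+1 = fun w => total n w + Zf n w); last first.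
  by apply/funext => w; rewrite totalS.
apply: measurable_funD; first by apply: IH; exact: ltnW.
exact: (@measurable_history _ _ _ _ _ (before s) Zf n ns).
Qed.

Lemma measurable_total s : measurable_fun setT (total s).
Proof.
apply: (@measurable_from_history _ _ _ _ _ (before s) Zf) => //.
exact: measurable_total_past.
Qed.

Let mblock s n : measurable_fun setT (fun w => total (s + n) w - total s w).
Proof. by apply: measurable_funB; exact: measurable_total. Qed.

Let next_claim s n A B : generated_sigma_algebra (before s) Zf A ->
  measurable B -> P (A `&` Z s @^-1` B) = (P A * P (Z n @^-1` B))%E.
Proof.
move=> sA mB; rewrite (@independent_of_history _ _ _ _ _ P _ Zf (before s))//.
  by congr (_ * _)%E; exact: (etrans (Zlaw s mB) (esym (Zlaw n mB))).
by rewrite /before/= ltnn.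
Qed.

(** Induction on [n]: the last claim of the block is independent of everything
    before it, so it can be frozen, and it may be replaced by the claim of index
    [n] because both have the same law. *)
Lemma block_independent s n A B :
  generated_sigma_algebra [set j | (j < s)%N] (fun j => Z j : T -> R) A ->
  measurable B ->
  P (A `&` (fun w => total (s + n) w - total s w) @^-1` B) =
  (P A * P (total n @^-1` B))%E.
Proof.
elim: n A B => [|n IH] A B sA mB.
  have [B0|B0] := pselect (B 0).
    rewrite (_ : _ @^-1` B = setT); last first.
      by apply/seteqP; split=> // w _ /=; rewrite addn0 subrr.
    rewrite (_ : _ @^-1` B = setT) ?setIT ?probability_setT ?mule1//.
    by apply/seteqP; split=> // w _ /=; rewrite total0.
  rewrite (_ : _ @^-1` B = set0); last first.
    by apply/seteqP; split=> // w /=; rewrite addn0 subrr.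
  rewrite (_ : _ @^-1` B = set0) ?setI0 ?measure0 ?mule0//.
  by apply/seteqP; split=> // w /=; rewrite total0.
have mA : measurable A by apply: history_measurable sA.
pose psi x := (\int[P]_w (\1_B (x + Z n w))%:E)%E.
have m1B : measurable_fun setT (fun z : R * R => \1_B (z.1 + z.2) : R).
  apply: measurableT_comp; first exact: measurable_indic.
  by apply: measurable_funD; [exact: measurable_fst|exact: measurable_snd].
have mpsi : measurable_fun setT psi.
  pose f z := (\1_B (z.1 + Z n z.2))%:E : \bar R.
  have mf : measurable_fun setT f.
    apply/measurable_EFinP.
    apply: (measurableT_comp m1B (g := fun z => (z.1, Z n z.2))).
    apply: measurable_fun_pair; first exact: measurable_fst.
    exact: measurableT_comp.
  by apply: (measurable_fun_fubini_tonelli_F (m2 := P) f) => // z; rewrite lee_fin.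
have psi_ge0 x : (0 <= psi x)%E by apply: integral_ge0 => w _; rewrite lee_fin.
have totalE : P (total n.+1 @^-1` B) = (\int[P]_w psi (total n w))%E.
  transitivity (\int[P]_w (\1_(total n.+1 @^-1` B) w)%:E)%E.
    rewrite integral_indic ?setIT//.
    by rewrite -[_ @^-1` _]setTI; exact: measurable_total.
  rewrite -(@integral_indep _ _ _ P _ _ _ _ (total n) (Z n) (Z n)
     (fun z => (\1_B (z.1 + z.2))%:E))//.
  - apply: eq_integral => w _ /=; congr (_%:E).
    rewrite !indicE; congr (_ %:R); congr nat_of_bool.
    by apply/idP/idP; rewrite !inE /= totalS.
  - exact: measurable_total.
  - move=> C D mC mD; rewrite (@next_claim n n)//.
    by rewrite -[_ @^-1` _]setTI; apply: (@measurable_total_past n n).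
  - exact/measurable_EFinP.
rewrite totalE.
transitivity (\int[P]_(w in A) psi (total (s + n) w - total s w)%R)%E; last first.
  apply: (@integral_indep_event _ _ _ P _ _ A
    (fun w => total (s + n) w - total s w) (total n) psi) => //.
  - exact: measurable_total.
  - by move=> C mC; exact: IH.
have sA' : generated_sigma_algebra (before (s + n)) Zf A.
  by apply: sub_history sA => j /= js; exact: ltn_addr.
have mVn : measurable_fun setT
    (fun w : past (s + n) => total (s + n) w - total s w).
  by apply: measurable_funB; apply: measurable_total_past => //; exact: leq_addr.
pose f (z : past (s + n) * R) : \bar R :=
  (\1_B (total (s + n) z.1 - total s z.1 + z.2))%:E.
have mf : measurable_fun setT f.
  apply/measurable_EFinP; apply: (measurableT_comp m1B
    (g := fun z : past (s + n) * R => (total (s + n) z.1 - total s z.1, z.2))).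
  apply: measurable_fun_pair; last exact: measurable_snd.
  by apply: (measurableT_comp mVn); exact: measurable_fst.
transitivity (\int[P]_(w in A)
    (\1_((fun w => total (s + n.+1) w - total s w)%R @^-1` B) w)%:E)%E.
  rewrite integral_indic 1?setIC//.
  by rewrite -[_ @^-1` _]setTI; exact: mblock.
transitivity (\int[P]_(w in A) f (w, Z (s + n) w))%E.
  apply: eq_integral => w _; rewrite !indicE; congr (_%:R%:E).
  by congr nat_of_bool; apply/idP/idP; rewrite !inE /= addnS totalS addrAC.
apply: (@integral_history_indep _ _ _ _ _ P _ (before (s + n)) Zf _ _ _ (Z n)) => //.
- by move=> C D mC mD; exact: next_claim.
- by move=> z; rewrite lee_fin.
Qed.

End claims.

(** * Random sums and the mean of the counting process *)

Section compound_sum.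
Context {d d2 : measure_display} {T : measurableType d}
  {T2 : measurableType d2} {R : realType}.
Variables (P : probability T R) (N : T -> nat) (S : nat -> T -> T2).
Hypothesis mN : measurable_fun setT N.
Hypothesis mS : forall n, measurable_fun setT (S n).

Let mNn n : measurable (N @^-1` [set n]).
Proof. by rewrite -[_ @^-1` _]setTI; exact: mN. Qed.

Let partN : \bigcup_n (N @^-1` [set n]) = setT.
Proof. by apply/seteqP; split => // w _; exists (N w). Qed.

Let trivN : trivIset setT (fun n => N @^-1` [set n]).
Proof. by move=> i j _ _ [w [/= <- <-]]. Qed.

Lemma measurable_compound : measurable_fun setT (fun w => S (N w) w).
Proof.
move=> _ B mB; rewrite setTI.
have -> : (fun w => S (N w) w) @^-1` B =
    \bigcup_n (N @^-1` [set n] `&` S n @^-1` B).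
  apply/seteqP; split => [w Bw|w [n _ [/= <-]]//].
  by exists (N w).
apply: bigcup_measurable => n _; apply: measurableI => //.
by rewrite -[_ @^-1` _]setTI; exact: mS.
Qed.

(** Conditioning on the value of the random index. *)
Lemma ge0_integral_compound (phi : T2 -> \bar R) :
  (forall n B, measurable B -> P (N @^-1` [set n] `&` S n @^-1` B) =
    (P (N @^-1` [set n]) * P (S n @^-1` B))%E) ->
  measurable_fun setT phi -> (forall y, (0 <= phi y)%E) ->
  (\int[P]_w phi (S (N w) w) =
   \sum_(n <oo) P (N @^-1` [set n]) * \int[P]_w phi (S n w))%E.
Proof.
move=> NS mphi phi0; rewrite -{1}partN ge0_integral_bigcup//; last first.
  by rewrite partN; apply: measurableT_comp => //; exact: measurable_compound.
apply: eq_eseriesr => n _.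
transitivity (\int[P]_(w in N @^-1` [set n]) phi (S n w))%E.
  by apply: eq_integral => w; rewrite inE /= => ->.
by apply: integral_indep_event => // B mB; exact: NS.
Qed.

End compound_sum.

Section natural_valued.
Context {d : measure_display} {T : measurableType d} {R : realType}.
Variable P : probability T R.

Lemma measurable_nat_fun (N : T -> nat) :
  (forall n, measurable (N @^-1` [set n])) -> measurable_fun setT N.
Proof.
move=> mN _ A _; rewrite setTI.
have -> : N @^-1` A = \bigcup_(n in A) N @^-1` [set n].
  by apply/seteqP; split => [w Aw|w [n An /= ->]//]; exists (N w).
by apply: bigcup_measurable => n _.
Qed.

Variable N : T -> nat.
Hypothesis mN : measurable_fun setT N.

Let mNn n : measurable (N @^-1` [set n]).
Proof. by rewrite -[_ @^-1` _]setTI; exact: mN. Qed.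

Lemma mean_nat : (\int[P]_w ((N w)%:R)%:E =
  \sum_(n <oo) n%:R%:E * P (N @^-1` [set n]))%E.
Proof.
have mid : measurable_fun setT (fun w => (N w)%:R : R).
  by apply: (@measurableT_comp _ _ _ _ _ _ (fun n => n%:R : R)).
rewrite (@ge0_integral_compound _ _ _ _ _ P N (fun n => cst n) mN _
  (fun n => (n%:R)%:E))//.
- apply: eq_eseriesr => n _.
  rewrite muleC; congr (_ * _)%E.
  transitivity (\int[P]_w (n%:R : R)%:E)%E => //.
  by rewrite integral_cst//= probability_setT mule1.
- move=> n B _; have [Bn|Bn] := pselect (B n).
    rewrite (_ : _ @^-1` B = setT) ?setIT ?probability_setT ?mule1//.
    by apply/seteqP; split.
  rewrite (_ : _ @^-1` B = set0) ?setI0 ?measure0 ?mule0//.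
  by apply/seteqP; split.
Qed.

Lemma law_nat : (\sum_(n <oo) P (N @^-1` [set n]) = 1)%E.
Proof.
rewrite -measure_semi_bigcup//; last 2 first.
- by move=> i j _ _ [w [/= <- <-]].
- exact: bigcup_measurable.
rewrite (_ : \bigcup_n (N @^-1` [set n]) = setT) /= ?probability_setT//.
by apply/seteqP; split => // w _; exists (N w).
Qed.

(** The size-bias identity [(n + 1) p_(n + 1) = x p_n] turns the mean into [x]
    times the total mass. *)
Lemma poisson_mean (x : R) : 0 < x ->
  (forall n, P (N @^-1` [set n]) = (poisson_pmf x n)%:E) ->
  (\int[P]_w ((N w)%:R)%:E)%E = x%:E.
Proof.
move=> x0 law; rewrite mean_nat.
have pos n : (0 <= (n%:R : R)%:E * P (N @^-1` [set n]))%E by rewrite mule_ge0.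
rewrite nneseries_recl// mul0e add0e -(@nneseries_addn _ (fun n => _ * P _)%E 1)//.
transitivity (\sum_(n <oo) x%:E * P (N @^-1` [set n]))%E.
  apply: eq_eseriesr => n _; rewrite !law addn1 -!EFinM; congr (_%:E).
  rewrite /poisson_pmf x0 factS natrM exprS invfM.
  by field; rewrite nat1r !pnatr_eq0 -lt0n fact_gt0.
by rewrite nneseriesZl// law_nat mule1.
Qed.

(** The prescribed masses add up to one, so all other values have mass zero. *)
Lemma mean_finite_support (k : nat) (p : 'I_k -> R) :
  (forall j : 'I_k, P (N @^-1` [set j.+1]) = (p j)%:E) ->
  \sum_(j < k) p j = 1 ->
  (\int[P]_w ((N w)%:R)%:E)%E = (\sum_(j < k) j.+1%:R * p j)%:E.
Proof.
move=> law p1; rewrite mean_nat.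
pose F := \big[setU/set0]_(j < k) N @^-1` [set j.+1].
have mF : measurable F by apply: bigsetU_measurable.
have PF : P F = 1%E.
  rewrite measure_bigsetU_ord//=.
    by rewrite (eq_bigr _ (fun j _ => law j)) sumEFin p1.
  by move=> i j _ _ [w [/= -> [/ord_inj]]].
have P0 n : (k < n)%N -> P (N @^-1` [set n]) = 0%E.
  move=> kn; apply: (@subset_measure0 _ _ _ P _ (~` F)) => //.
  - exact: measurableC.
  - move=> w /= Nw; rewrite /F.
    elim/big_ind : _ => [//|A B nA nB [/nA|/nB]//|j _ /=].
    by rewrite Nw => nj; move: kn; rewrite nj ltnNge ltn_ord.
  - by apply: etrans (probability_setC P mF) _; rewrite PF subee.
rewrite (nneseries_split 0 k.+1) ?add0n; last by move=> n _; rewrite mule_ge0.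
rewrite eseries0 ?adde0; last by move=> n kn _; rewrite P0// mule0.
rewrite big_mkord big_ord_recl/= mul0e add0e -sumEFin.
by apply: eq_bigr => j _; rewrite law -EFinM.
Qed.

End natural_valued.

Section compound_mean.
Context {d : measure_display} {T : measurableType d} {R : realType}.
Variables (P : probability T R) (N : T -> nat) (Z : nat -> T -> R) (m : R).
Hypothesis mN : measurable_fun setT N.
Hypothesis mZ : forall j, measurable_fun setT (Z j).
Hypothesis Z_ge0 : forall j w, 0 <= Z j w.
Hypothesis mean_Z : forall j, (\int[P]_w (Z j w)%:E = m%:E)%E.

Let S n w := \sum_(j < n) Z j w.

Let mS n : measurable_fun setT (S n).
Proof. exact: measurable_sum. Qed.

(** Wald's identity. *)
Lemma compound_mean :
  (forall n B, measurable B -> P (N @^-1` [set n] `&` S n @^-1` B) =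
    (P (N @^-1` [set n]) * P (S n @^-1` B))%E) ->
  (\int[P]_w (\sum_(j < N w) Z j w)%:E = m%:E * \int[P]_w ((N w)%:R)%:E)%E.
Proof.
move=> NS; have m0 : 0 <= m.
  by rewrite -lee_fin -(mean_Z 0) integral_ge0// => w _; rewrite lee_fin.
have S_ge0 n w : 0 <= S n w by exact: sumr_ge0.
transitivity (\int[P]_w (`|S (N w) w|%:E))%E.
  by apply: eq_integral => w _; rewrite ger0_norm.
rewrite (@ge0_integral_compound _ _ _ _ _ P N S mN mS (fun y => `|y|%:E))//; last first.
  by apply/measurable_EFinP; exact: normr_measurable.
rewrite (mean_nat P mN) -nneseriesZl; last by move=> n _; rewrite mule_ge0.
apply: eq_eseriesr => n _.
rewrite [RHS]muleA [RHS]muleC; congr (_ * _)%E.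
transitivity (\int[P]_w (\sum_(j < n) (Z j w)%:E))%E.
  by apply: eq_integral => w _; rewrite ger0_norm// /S sumEFin.
rewrite ge0_integral_sum//; last 2 first.
- by move=> j; exact/measurable_EFinP.
- by move=> j w _; rewrite lee_fin.
under eq_bigr do rewrite mean_Z.
rewrite sumEFin -EFinM; congr (_%:E).
by rewrite sumr_const card_ord mulr_natr.
Qed.

End compound_mean.

Lemma measurable_nat_sum {d : measure_display} {T : measurableType d}
    (R : realType) (N : T -> nat) (X : nat -> T -> nat) :
  measurable_fun setT N -> (forall i, measurable_fun setT (X i)) ->
  measurable_fun setT (fun w => (\sum_(i < N w) X i w)%N).
Proof.
move=> mN mX; pose S n w : R := \sum_(i < n) (X i w)%:R.
have mS n : measurable_fun setT (S n).
  apply: measurable_sum => i.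
  exact: (@measurableT_comp _ _ _ _ _ _ (fun n => n%:R : R)).
apply: measurable_nat_fun => n.
have -> : (fun w => (\sum_(i < N w) X i w)%N) @^-1` [set n] =
    (fun w => S (N w) w) @^-1` [set n%:R].
  apply/seteqP; split => w /=; rewrite /S -natr_sum; first by move=> ->.
  by move=> /eqP; rewrite eqr_nat => /eqP.
rewrite -[_ @^-1` _]setTI.
exact: (measurable_compound mN mS _ (measurable_set1 _)).
Qed.

Section counting_process.
Context {d : measure_display} {T : measurableType d} {R : realType}.
Variables (P : probability T R) (k : nat) (lambda : 'I_k -> R).
Variable M : R -> {RV P >-> nat}.
Hypothesis k_gt0 : (0 < k)%N.
Hypothesis lambda_gt0 : forall j, 0 < lambda j.
Hypothesis M_gcp : generalized_counting_process lambda M.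
Variable t : R.
Hypothesis t_gt0 : 0 < t.

Let Lambda := \sum_(j < k) lambda j.

Lemma total_rate_gt0 : 0 < Lambda.
Proof.
rewrite /Lambda; case: k k_gt0 lambda lambda_gt0 => // k' _ l l0.
rewrite big_ord_recl ltr_pwDl//; apply: sumr_ge0 => j _; exact: ltW.
Qed.

(** The mean only depends on the law of [M t], which is the law of a Poisson sum
    of jumps on the auxiliary space, where Wald's identity applies. *)
Lemma gcp_mean : (\int[P]_w ((M t w)%:R)%:E)%E =
  (t * \sum_(j < k) j.+1%:R * lambda j)%:E.
Proof.
have L0 := total_rate_gt0.
have [_ [d' [T' [P' [N [X [[_ Nlaw] Xind Xlaw NX Mlaw]]]]]]] := M_gcp.
pose Xr i w : R := (X i w)%:R.
have mXr i : measurable_fun setT (Xr i).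
  by apply: (@measurableT_comp _ _ _ _ _ _ (fun n => n%:R : R)).
pose S n w := \sum_(i < n) Xr i w.
have mS n : measurable_fun setT (S n) by exact: measurable_sum.
pose K w := (\sum_(i < N t w) X i w)%N.
have KE w : (K w)%:R = S (N t w) w by rewrite /K natr_sum.
have mK : measurable_fun setT K.
  apply: (@measurable_nat_sum _ T' R (N t) (fun i => X i)) => *;
    exact: measurable_funPT.
rewrite mean_nat//.
transitivity (\int[P']_w ((K w)%:R)%:E)%E.
  rewrite mean_nat//; apply: eq_eseriesr => n _; congr (_ * _)%E.
  exact: (Mlaw t [set n] (ltW t_gt0)).
under eq_integral do rewrite KE.
have tL : 0 < Lambda * t by rewrite mulr_gt0.
rewrite (@compound_mean _ _ _ P' (N t) Xr
   (\sum_(j < k) j.+1%:R * (lambda j / Lambda)))//.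
- rewrite (@poisson_mean _ _ _ P' (N t) _ (Lambda * t))//; last first.
    by move=> n; exact: Nlaw.
  rewrite -EFinM mulr_suml mulr_sumr; congr (_%:E); apply: eq_bigr => j _.
  by rewrite mulrCA mulrA; field; rewrite gt_eqF.
- move=> i; apply: mean_finite_support => //.
    by move=> j; exact: Xlaw.
  by rewrite -mulr_suml divff// gt_eqF.
- move=> n B mB; apply: NX.
    apply: sub_sigma_algebra; exists t; first exact: ltW.
    by exists [set n] => //; rewrite setTI.
  pose hist := history [set: nat] (fun i => X i : T' -> nat).
  have mXh i : measurable_fun setT (X i : hist -> nat).
    exact: (@measurable_history _ _ _ _ _ [set: nat] (fun i => X i : T' -> nat)).
  have mSh : measurable_fun setT (S n : hist -> R).
    apply: measurable_sum => i.
    exact: (@measurableT_comp _ _ _ _ _ _ (fun n => n%:R : R) _ (X i : hist -> nat)).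
  by have := mSh measurableT B mB; rewrite setTI.
Qed.

(** No Poisson event, no jump. *)
Lemma gcp_no_jump : ((expR (- (Lambda * t)))%:E <= P (M t @^-1` [set 0%N]))%E.
Proof.
have L0 := total_rate_gt0.
have [_ [d' [T' [P' [N [X [[_ Nlaw] Xind Xlaw NX Mlaw]]]]]]] := M_gcp.
have := Mlaw t [set 0%N] (ltW t_gt0); rewrite /distribution/= /pushforward => ->.
have := Nlaw t 0%N t_gt0; rewrite /distribution/= /pushforward.
rewrite /poisson_pmf mulr_gt0// expr0 fact0 invr1 !mul1r => <-.
apply: le_measure; rewrite ?inE.
- by rewrite -[_ @^-1` _]setTI; apply: (measurable_funPT (N t)).
- have mK : measurable_fun setT (fun w => (\sum_(i < N t w) X i w)%N).
    by apply: (measurable_nat_sum R (X := fun i => X i)) => *; exact: measurable_funPT.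
  by rewrite -[X in measurable X]setTI; exact: (mK measurableT [set 0%N]).
- by move=> w /= ->; rewrite big_ord0.
Qed.

End counting_process.

(** * The surplus on a time grid is a random walk *)

Section grid_survival.
Context {d : measure_display} {T : measurableType d} {R : realType}.
Variables (P : probability T R) (c h : R).
Variables (M : R -> {RV P >-> nat}) (Z : nat -> {RV P >-> R}).
Hypothesis h_gt0 : 0 < h.
Hypothesis Mlevy : levy_process P (fun t w => (M t w)%:R : R).
Hypothesis Zind : mutually_independent P (fun j => Z j : T -> R).
Hypothesis Zlaw : forall j (B : set R), measurable B ->
  P (Z j @^-1` B) = P (Z 0%N @^-1` B).
Hypothesis MZind : independent_families P (@nneg_times R)
  (fun t => M t : T -> nat) [set: nat] (fun j => Z j : T -> R).

Let time (i : nat) : R := i%:R * h.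

Let time_ge0 i : 0 <= time i. Proof. by rewrite mulr_ge0// ltW. Qed.

Let timeS i : time i.+1 = time i + h.
Proof. by rewrite /time -natr1 mulrDl mul1r. Qed.

(** Stated with an addition so as to exclude decreasing counts, which the truncated
    difference of natural numbers would not do. *)
Definition jumps (a : nat) (delta : nat -> nat) : set T :=
  [set w | forall i, (i < a)%N -> M (time i.+1) w = (M (time i) w + delta i)%N].

Lemma count_at0 w : M 0 w = 0%N.
Proof. by case: Mlevy => _ /(_ w) /eqP; rewrite pnatr_eq0 => /eqP. Qed.

Lemma jumps_count a delta w :
  jumps a delta w -> M (time a) w = (\sum_(i < a) delta i)%N.
Proof.
elim: a => [|a IH] J; first by rewrite big_ord0 /time mul0r count_at0.
rewrite big_ord_recr /= J// IH// => i ia; apply: J; exact: ltnW.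
Qed.

Lemma jumps_counting_event a delta :
  generated_sigma_algebra (@nneg_times R) (fun t => M t : T -> nat) (jumps a delta).
Proof.
pose hist := history (@nneg_times R) (fun t => M t : T -> nat).
have mM t n : 0 <= t -> measurable (M t @^-1` [set n] : set hist).
  move=> t0; rewrite -[_ @^-1` _]setTI.
  exact: (@measurable_history _ _ _ _ _ (@nneg_times R) (fun t => M t : T -> nat)).
suff -> : jumps a delta = \bigcap_(i in `I_a) \bigcup_m
    (M (time i) @^-1` [set m] `&` M (time i.+1) @^-1` [set (m + delta i)%N]).
  have -> : generated_sigma_algebra (@nneg_times R) (fun t => M t : T -> nat) =
    @measurable _ hist by [].
  apply: bigcap_measurableType => i _; apply: bigcup_measurable => m _.
  by apply: measurableI; exact: mM.
apply/seteqP; split => w J i ia.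
  by exists (M (time i) w) => //; split => //=; exact: J.
by have [m _ [/= -> ->]] := J i ia.
Qed.

Lemma jumps_measurable a delta : measurable (jumps a delta).
Proof. by apply: history_measurable (jumps_counting_event a delta) => t _. Qed.

Let incr_law i (B : set R) : measurable B ->
  P [set w | B ((M (time i.+1) w)%:R - (M (time i) w)%:R)] =
  P [set w | B (M h w)%:R].
Proof.
move=> mB; case: Mlevy => _ M0 _ Mstat _.
rewrite timeS Mstat// ?ltW//; congr (P _).
by apply/funext => w /=; rewrite M0 subr0.
Qed.

(** A path may decrease, but by stationarity an increment is distributed like
    [M h], which is nonnegative. *)
Lemma count_nondecreasing_ae i :
  P [set w | (M (time i.+1) w < M (time i) w)%N] = 0%E.
Proof.
have := incr_law i (measurable_itv `]-oo, 0[).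
rewrite (_ : [set w | _ (M h w)%:R] = set0) ?measure0; last first.
  by apply/seteqP; split => // w; rewrite /= in_itv/= ltrn0.
by move=> <-; congr (P _); apply/funext => w /=; rewrite in_itv/= subr_lt0 ltr_nat.
Qed.

(** Independent increments give a product formula for [jumps], and stationarity
    makes each factor a value of the law of [M h]. *)
Lemma jumpsS_law a delta :
  P (jumps a.+1 delta) = (P (jumps a delta) * P (M h @^-1` [set delta a]))%E.
Proof.
have law b : P (jumps b delta) =
    (\prod_(i <- iota 0 b) P (M h @^-1` [set delta i]))%E.
  case: Mlevy => _ _ Minc _ _.
  have tmono : {homo time : m n / (m <= n)%N >-> m <= n}.
    by move=> m n mn; rewrite /time ler_wpM2r ?ler_nat// ltW.
  have factor i : P (M h @^-1` [set delta i]) =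
      P ((fun w => (M (time i.+1) w)%:R - (M (time i) w)%:R : R) @^-1`
        [set (delta i)%:R]).
    rewrite (_ : _ @^-1` [set (delta i)%:R] = [set w | [set (delta i)%:R : R]
      ((M (time i.+1) w)%:R - (M (time i) w)%:R)])//.
    rewrite (incr_law i (measurable_set1 _)); congr (P _).
    apply/seteqP; split => w /=; first by move=> ->.
    by move=> /eqP; rewrite eqr_nat => /eqP.
  have := Minc time (time_ge0 0) tmono (iota 0 b) (fun i => [set (delta i)%:R])
    (iota_uniq _ _) (fun i => measurable_set1 _).
  rewrite (eq_bigr _ (fun i _ => factor i)) => <-.
  congr (P _); apply/seteqP; split => w J i /=.
    rewrite mem_iota/= add0n => /J ->.
    by rewrite natrD addrC addKr.
  move=> ib; have := J i; rewrite /= mem_iota/= add0n ib => /(_ isT) /eqP.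
  by rewrite subr_eq -natrD eqr_nat addnC => /eqP.
rewrite !law -addn1 iotaD big_cat /= add0n; congr (_ * _)%E.
by rewrite big_cons big_nil mule1.
Qed.

Let count_event t n : measurable (M t @^-1` [set n]).
Proof. by rewrite -[_ @^-1` _]setTI; exact: measurable_funPT. Qed.

Definition solvent (a n : nat) : set T :=
  [set w | forall j, (j <= n)%N ->
    0 <= c * time (a + j) - total Z (M (time (a + j)) w) w].

Let claims_upto (t : R) (w : T) : R := total Z (M t w) w.

Lemma measurable_claims_upto t : measurable_fun setT (claims_upto t).
Proof. exact: (measurable_compound _ (measurable_total Z)). Qed.

Lemma solvent_measurable a n : measurable (solvent a n).
Proof.
have -> : solvent a n = \bigcap_(j in `I_n.+1)
    ((fun w => c * time (a + j) - claims_upto (time (a + j)) w) @^-1` `[0, +oo[).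
  apply/seteqP; split => w J j /=.
    by move=> jn; rewrite in_itv/= andbT; exact: J.
  by move=> jn; have := J j jn; rewrite /= in_itv/= andbT.
apply: bigcap_measurableType => j _; rewrite -[_ @^-1` _]setTI.
apply: measurable_funB => //; exact: measurable_claims_upto.
Qed.

Let xi (w : T) : R := c * h - claims_upto h w.
Hypothesis xi_int : P.-integrable setT (EFin \o xi).

Let before (s : nat) : set nat := [set j | (j < s)%N].
Let Zf := fun j => Z j : T -> R.

Let claims_history s : generated_sigma_algebra (before s) Zf `<=`
  generated_sigma_algebra [set: nat] Zf.
Proof. exact: sub_history. Qed.

Let indep_jumps_claims a delta s A :
  generated_sigma_algebra (before s) Zf A ->
  P (jumps a delta `&` A) = (P (jumps a delta) * P A)%E.
Proof.
by move=> sA; apply: MZind; [exact: jumps_counting_event|exact: claims_history sA].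
Qed.

Let count_indep_total n B : measurable B ->
  P (M h @^-1` [set n] `&` total Z n @^-1` B) =
  (P (M h @^-1` [set n]) * P (total Z n @^-1` B))%E.
Proof.
move=> mB; apply: MZind.
  apply: sub_sigma_algebra; exists h; first exact: ltW.
  by exists [set n] => //; rewrite setTI.
apply: (@claims_history n).
have := @measurable_total_past _ _ _ P Z n n (leqnn n) measurableT B mB.
by rewrite setTI.
Qed.

Let solvent_now (a s : nat) (A : set T) : set T :=
  A `&` [set w | 0 <= c * time a - total Z s w].

Let solvent_now_history a s A : generated_sigma_algebra (before s) Zf A ->
  generated_sigma_algebra (before s) Zf (solvent_now a s A).
Proof.
move=> sA; rewrite /solvent_now.
have -> : [set w | 0 <= c * time a - total Z s w] =
    (fun w : history (before s) Zf => c * time a - total Z s w) @^-1` `[0, +oo[.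
  by apply/seteqP; split => w /=; rewrite in_itv/= andbT.
have mf : measurable_fun setT
    (fun w : history (before s) Zf => c * time a - total Z s w).
  by apply: measurable_funB => //; exact: (@measurable_total_past _ _ _ P Z s s).
have mA : measurable (A : set (history (before s) Zf)) by exact: sA.
have := measurableI _ _ mA (mf measurableT _ (measurable_itv `[0, +oo[)).
by rewrite setTI.
Qed.

(** The Markov property of the surplus on the grid.  Once the numbers of claims in
    the first [a] intervals are fixed, with sum [s], the surplus at grid time [a]
    is a function of the first [s] claims, and survival during [n] further steps
    has the conditional probability given by [survival].  The statement carries an
    event [A] of the history of these claims, so that solvency at time [a] can be
    absorbed into it when the induction moves to time [a + 1]. *)
Lemma solvent_law (n a : nat) (delta : nat -> nat) (A : set T) :
  generated_sigma_algebra [set j | (j < \sum_(i < a) delta i)%N]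
    (fun j => Z j : T -> R) A ->
  P (jumps a delta `&` A `&` solvent a n) =
  (P (jumps a delta) * \int[P]_(w in A)
    (survival P xi n (c * time a - total Z (\sum_(i < a) delta i)%N w))%:E)%E.
Proof.
elim: n a delta A => [|n IH] a delta A; set s := (\sum_(i < a) delta i)%N => sA;
    have sA' := solvent_now_history a sA;
    have mA : measurable A by [apply: history_measurable sA];
    have mA' : measurable (solvent_now a s A) by [apply: history_measurable sA'].
  have -> : jumps a delta `&` A `&` solvent a 0 =
      jumps a delta `&` solvent_now a s A.
    apply/seteqP; split => [w [[J Aw] S]|w [J [Aw S]]].
      split=> //; split=> //=; have := S 0%N (leqnn _).
      by rewrite addn0 (jumps_count J).
    split=> // j; rewrite leqn0 => /eqP ->.
    by rewrite addn0 (jumps_count J).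
  rewrite (indep_jumps_claims _ _ sA'); congr (_ * _)%E.
  have mS : measurable [set w | 0 <= c * time a - total Z s w].
    have := solvent_now_history a (@measurableT _ (history (before s) Zf)).
    by rewrite /solvent_now setTI; apply: history_measurable.
  transitivity (\int[P]_(w in A)
      (\1_[set w | 0 <= c * time a - total Z s w] w)%:E)%E.
    by rewrite integral_indic// setIC.
  apply: eq_integral => w _ /=; rewrite indicE; congr (_%:E).
  case: ifPn => S; first by rewrite mem_set.
  by rewrite memNset//; exact/negP.
set A' := solvent_now a s A in sA' mA' *.
(* Solvency at time [a] is an event of the history of the first [s] claims. *)
pose C := jumps a delta `&` A' `&` solvent a.+1 n.
have CE : jumps a delta `&` A `&` solvent a n.+1 = C.
  apply/seteqP; split => [w [[J Aw] S]|w [[J [Aw S0]] S]].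
    split; last by move=> j jn; rewrite addSnnS; exact: S.
    split=> //; split=> //=; have := S 0%N (leq0n _).
    by rewrite addn0 (jumps_count J).
  split=> // -[_|j jn]; first by rewrite addn0 (jumps_count J).
  by rewrite -addSnnS; exact: S.
rewrite CE.
have mC : measurable C.
  apply: measurableI; last exact: solvent_measurable.
  by apply: measurableI => //; exact: jumps_measurable.
pose J k := [set w | M (time a.+1) w = (M (time a) w + k)%N].
have mJ k : measurable (J k).
  have -> : J k = \bigcup_m (M (time a) @^-1` [set m] `&`
      M (time a.+1) @^-1` [set (m + k)%N]).
    apply/seteqP; split => w /=; first by move=> H; exists (M (time a) w).
    by move=> [m _ [/= <- ]].
  by apply: bigcup_measurable => m _; apply: measurableI; exact: count_event.
(* Conditioning on the number of claims in the next interval. *)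
have PC : P C = (\sum_(k <oo) P (C `&` J k))%E.
  rewrite -measure_semi_bigcup; last 3 first.
  - by move=> k; exact: measurableI.
  - move=> i j _ _ [w [[_ /= e1] [_ /= e2]]].
    by apply/eqP; rewrite -(eqn_add2l (M (time a) w)) -e1 -e2.
  - by apply: bigcup_measurable => k _; exact: measurableI.
  rewrite -setI_bigcupr.
  apply/esym/measure_setI_full => //; first exact: bigcup_measurable.
  rewrite -(count_nondecreasing_ae a); congr (P _); apply/seteqP; split => w /=.
    apply: contra_notT; rewrite -leqNgt => le.
    by exists (M (time a.+1) w - M (time a) w)%N => //=; rewrite /J/= subnKC.
  by move=> lt [k _ /= e]; move: lt; rewrite e ltnNge leq_addr.
rewrite PC.
pose delta' k i := if i == a then k else delta i.
have delta'_lt k i : (i < a)%N -> delta' k i = delta i.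
  by move=> ia; rewrite /delta' ltn_eqF.
have jumps' k : jumps a (delta' k) = jumps a delta.
  by apply/seteqP; split => w H i ia; rewrite H// delta'_lt.
have sum_delta' k : (\sum_(i < a.+1) delta' k i = s + k)%N.
  rewrite big_ord_recr /= {2}/delta' eqxx; congr (_ + _)%N.
  by apply: eq_bigr => i _; rewrite delta'_lt.
have CJ k : C `&` J k = jumps a.+1 (delta' k) `&` A' `&` solvent a.+1 n.
  apply/seteqP; split => [w [[[H Aw] S] Jk]|w [[H Aw] S]].
    split=> //; split=> // i; rewrite ltnS leq_eqVlt => /orP[/eqP ->|ia].
      by rewrite Jk /delta' eqxx.
    by rewrite delta'_lt//; exact: H.
  split; last by rewrite /J/= H// /delta' eqxx.
  split=> //; split=> // i ia; rewrite -(delta'_lt k)//; apply: H.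
  exact: ltnW.
pose X w := c * time a - total Z s w.
have step k : (P (C `&` J k) = P (jumps a delta) * (P (M h @^-1` [set k]) *
    \int[P]_(w in A') \int[P]_w'
      (survival P xi n (X w + (c * h - total Z k w')))%:E))%E.
  rewrite CJ IH; last first.
    rewrite sum_delta'; apply: sub_history sA' => j /= js; exact: ltn_addr.
  rewrite jumpsS_law jumps' {1}/delta' eqxx -muleA sum_delta'; congr (_ * (_ * _))%E.
  pose f (z : history (before s) Zf * R) : \bar R :=
    (survival P xi n (c * time a - total Z s z.1 + (c * h - z.2)))%:E.
  have mf : measurable_fun setT f.
    apply/measurable_EFinP.
    apply: (measurableT_comp (measurable_survival xi_int n)).
    apply: measurable_funD; apply: measurable_funB => //.
    apply: (measurableT_comp (@measurable_total_past _ _ _ P Z s s (leqnn s))).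
    exact: measurable_fst.
  have mtotal := measurable_total Z.
  have := @integral_history_indep _ _ _ _ _ P _ (before s) Zf _ _
    (fun w => total Z (s + k) w - total Z s w) (total Z k) A' f.
  rewrite /f/= => <- //.
  - apply: eq_integral => w _; congr (survival _ _ _ _)%:E.
    by rewrite timeS; lra.
  - exact: measurable_funB.
  - by move=> B D sB mD; exact: block_independent.
  - by move=> z; rewrite lee_fin survival_ge0.
under eq_eseriesr do rewrite step.
have term_ge0 k : (0 <= P (M h @^-1` [set k]) *
    \int[P]_(w in A') \int[P]_w'
      (survival P xi n (X w + (c * h - total Z k w')))%:E)%E.
  rewrite mule_ge0// integral_ge0// => w _; rewrite integral_ge0// => w' _.
  by rewrite lee_fin survival_ge0.
have -> : P (jumps a delta) = (fine (P (jumps a delta)))%:E.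
  by rewrite fineK// fin_num_measure//; exact: jumps_measurable.
rewrite nneseriesZl//; congr (_ * _)%E.
pose G k w := (\int[P]_w' (survival P xi n (X w + (c * h - total Z k w')))%:E)%E.
have mX : measurable_fun setT X.
  by apply: measurable_funB => //; exact: measurable_total.
have mG k : measurable_fun setT (G k).
  pose f (z : T * T) := (survival P xi n (X z.1 + (c * h - total Z k z.2)))%:E.
  apply: (measurable_fun_fubini_tonelli_F (m2 := P) f); last first.
    by move=> z; rewrite lee_fin survival_ge0.
  apply/measurable_EFinP; apply: (measurableT_comp (measurable_survival xi_int n)).
  apply: measurable_funD; first by apply: measurableT_comp.
  apply: measurable_funB => //.
  by apply: (measurableT_comp (measurable_total Z k)); exact: measurable_snd.
have G0 k w : (0 <= G k w)%E.
  by rewrite integral_ge0// => w' _; rewrite lee_fin survival_ge0.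
transitivity (\int[P]_(w in A') \sum_(k <oo) P (M h @^-1` [set k]) * G k w)%E.
  rewrite integral_nneseries//.
  - apply: eq_eseriesr => k _; rewrite ge0_integralZl//.
    exact: measurable_funTS.
  - by move=> k; apply: emeasurable_funM => //; exact: measurable_funTS.
  - by move=> k w _; rewrite mule_ge0.
rewrite /A' /solvent_now integral_mkcondr; apply: eq_integral => w _.
rewrite patchE; have [X0|X0] := leP 0 (X w); last first.
  rewrite memNset ?survival_lt0//.
  by move=> /=; apply/negP; rewrite -ltNge.
rewrite mem_set// survivalS// /Rintegral fineK; last first.
  exact: (integrable_fin_num measurableT (integrable_survival xi_int n (X w))).
apply/esym; apply: (@ge0_integral_compound _ _ _ _ _ P _ (total Z) _ _
  (fun y => (survival P xi n (X w + (c * h - y)))%:E)) => //.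
- exact: measurable_total.
- apply/measurable_EFinP; apply: (measurableT_comp (measurable_survival xi_int n)).
  by apply: measurable_funD => //; exact: measurable_funB.
- by move=> y; rewrite lee_fin survival_ge0.
Qed.

Lemma solvent_probability n : P (solvent 0 n) = (survival P xi n 0)%:E.
Proof.
have := @solvent_law n 0 (fun=> 0%N) setT; rewrite big_ord0.
have -> : jumps 0 (fun=> 0%N) = setT by apply/seteqP; split.
rewrite !setTI probability_setT mul1e => ->; last first.
  exact: (@measurableT _ (history (before 0) Zf)).
under eq_integral do rewrite total0 subr0 /time mul0r mulr0.
by rewrite integral_cst//= probability_setT mule1.
Qed.

End grid_survival.

(** * From the grid to continuous time *)

Section ruin.
Context {d : measure_display} {T : measurableType d} {R : realType}.
Variables (P : probability T R) (k : nat) (lambda : 'I_k -> R) (c : R).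
Variables (M : R -> {RV P >-> nat}) (Z : nat -> {RV P >-> R}) (mu : R).
Hypothesis k_gt0 : (0 < k)%N.
Hypothesis lambda_gt0 : forall j, 0 < lambda j.
Hypothesis c_gt0 : 0 < c.
Hypothesis M_gcp : generalized_counting_process lambda M.
Hypothesis Z_ge0 : forall j w, 0 <= Z j w.
Hypothesis Zind : mutually_independent P (fun j => Z j : T -> R).
Hypothesis Zlaw : forall j (B : set R), measurable B ->
  P (Z j @^-1` B) = P (Z 0%N @^-1` B).
Hypothesis MZind : independent_families P (@nneg_times R)
  (fun t => M t : T -> nat) [set: nat] (fun j => Z j : T -> R).
Hypothesis mean_Z : forall j, (\int[P]_w (Z j w)%:E = mu%:E)%E.

Let rate := \sum_(j < k) j.+1%:R * lambda j.
Hypothesis net_profit : mu * rate <= c.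

Let Lambda := \sum_(j < k) lambda j.
Let rho := mu / c * rate.
Let claims t w := total Z (M t w) w.

Let M_levy : levy_process P (fun t w => (M t w)%:R : R).
Proof. by case: M_gcp. Qed.

Let mclaims t : measurable_fun setT (claims t).
Proof. exact: (measurable_compound _ (measurable_total Z)). Qed.

Let claims_ge0 t w : 0 <= claims t w.
Proof. by apply: sumr_ge0 => j _; exact: Z_ge0. Qed.

Definition grid_survives (h : R) : set T :=
  [set w | forall j : nat, 0 <= c * (j%:R * h) - claims (j%:R * h) w].

Lemma measurable_grid_survives h : measurable (grid_survives h).
Proof.
have -> : grid_survives h = \bigcap_j
    ((fun w => c * (j%:R * h) - claims (j%:R * h) w) @^-1` `[0, +oo[).
  apply/seteqP; split => w J j /=; first by move=> _; rewrite in_itv/= andbT.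
  by have := J j I; rewrite /= in_itv/= andbT.
apply: bigcap_measurableType => j _; rewrite -[_ @^-1` _]setTI.
by apply: measurable_funB.
Qed.

Section one_step.
Variable h : R.
Hypothesis h_gt0 : 0 < h.

Let xi w := c * h - claims h w.

Lemma mean_claims : (\int[P]_w (claims h w)%:E)%E = (mu * (h * rate))%:E.
Proof.
rewrite /claims /total (@compound_mean _ _ _ P (M h) (fun j => Z j : T -> R) mu)//.
- by rewrite (gcp_mean k_gt0 lambda_gt0 M_gcp h_gt0) -EFinM.
- move=> n B mB; apply: MZind.
    apply: sub_sigma_algebra; exists h; first exact: ltW.
    by exists [set n] => //; rewrite setTI.
  have := @measurable_total_past _ _ _ P Z n n (leqnn n) measurableT B mB.
  by rewrite setTI; apply: sub_history.
Qed.

Let claims_int : P.-integrable setT (EFin \o claims h).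
Proof.
apply/integrableP; split; first exact/measurable_EFinP.
under eq_integral do rewrite /= ger0_norm//.
by rewrite mean_claims ltry.
Qed.

Let int_cst (r : R) : P.-integrable setT (EFin \o cst r).
Proof. exact: finite_measure_integrable_cst. Qed.

Let xi_int : P.-integrable setT (EFin \o xi).
Proof.
exact: (integrableB measurableT (int_cst _) claims_int).
Qed.

Let xi_le w : xi w <= c * h.
Proof. by rewrite gerBl. Qed.

Let ch_gt0 : 0 < c * h. Proof. exact: mulr_gt0. Qed.

Let mean_xi : \int[P]_w xi w = c * h * (1 - rho).
Proof.
have -> : \int[P]_w xi w = c * h - mu * (h * rate).
  transitivity (\int[P]_w (c * h) - \int[P]_w claims h w).
    exact: (RintegralB measurableT (int_cst _) claims_int).
  rewrite [X in _ - X]/Rintegral mean_claims; congr (_ - _).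
  by rewrite Rintegral_cst//= probability_setT mulr1.
by rewrite /rho; field; rewrite gt_eqF.
Qed.

Lemma grid_survives_probability :
  P (grid_survives h) = (ultimate_survival P xi 0)%:E.
Proof.
have -> : grid_survives h = \bigcap_n solvent c h M Z 0 n.
  apply/seteqP; split => [w H n _ j _|w H j]; first by rewrite add0n; exact: H.
  by have := H j I j (leqnn j); rewrite add0n.
have cvgP : (P (solvent c h M Z 0 n) @[n --> \oo] -->
    P (\bigcap_n solvent c h M Z 0 n))%E.
  apply: nonincreasing_cvg_mu.
  - rewrite (le_lt_trans (probability_le1 _ _))// ?ltry//.
    exact: solvent_measurable.
  - by move=> n; exact: solvent_measurable.
  - by apply: bigcap_measurableType => n _; exact: solvent_measurable.
  - move=> m n mn; apply/subsetPset => w H j jm; apply: H.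
    exact: leq_trans mn.
have eqP n : P (solvent c h M Z 0 n) = (survival P xi n 0)%:E.
  exact: (solvent_probability h_gt0 M_levy Zind Zlaw MZind xi_int).
have cvgU : (P (solvent c h M Z 0 n) @[n --> \oo] -->
    (ultimate_survival P xi 0)%:E)%E.
  rewrite (funext eqP); apply: cvg_EFin; first exact: nearW.
  exact: (@cvg_survival _ _ _ P xi xi_int 0).
exact: (cvg_unique _ cvgP cvgU).
Qed.

(** The random walk bounds for [b = c h]: the largest step is reached when no claim
    arrives. *)
Lemma grid_survives_bounds :
  1 - rho <= ultimate_survival P xi 0 <= (1 - rho) * expR (Lambda * h).
Proof.
apply/andP; split.
  rewrite -(ler_pM2l ch_gt0) -mean_xi.
  have c1 := @cvg_survival _ _ _ P xi xi_int 0.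
  rewrite -cvg_shiftS in c1.
  apply: (@ler_cvg_to _ \oo _ _ (fun=> \int[P]_w xi w)
    (fun n => c * h * survival P xi n.+1 0)); first exact: cvg_cst.
    exact: cvgMr.
  by apply: nearW => n; exact: mean_le_survival.
have rho1 : 0 <= 1 - rho by rewrite subr_ge0 /rho mulrAC ler_pdivrMr// mul1r.
have := ultimate_survival_le_mean xi_int xi_le.
rewrite mean_xi => /(_ (mulr_ge0 (ltW ch_gt0) rho1)).
rewrite mulrCA ler_pM2l// => le_p.
have p_ge : expR (- (Lambda * h)) <= fine (P [set w | xi w = c * h]).
  have mxi : measurable [set w | xi w = c * h].
    have mf : measurable_fun setT xi by exact: measurable_funB.
    by have := mf measurableT _ (measurable_set1 (c * h)); rewrite setTI.
  rewrite -lee_fin fineK ?fin_num_measure//.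
  apply: le_trans (gcp_no_jump k_gt0 lambda_gt0 M_gcp h_gt0) _.
  apply: le_measure; rewrite ?inE.
  - by rewrite -[_ @^-1` _]setTI; exact: measurable_funPT.
  - exact: mxi.
  - by move=> w /= Mw; rewrite /xi /claims Mw total0 subr0.
rewrite -ler_pdivrMr ?expR_gt0// -expRN mulrC.
by apply: le_trans le_p; rewrite ler_wpM2r// ultimate_survival_ge0.
Qed.

End one_step.

Definition survives : set T :=
  [set w | forall t, 0 < t -> 0 <= c * t - claims t w].

Let mesh (m : nat) : R := 2^-1 ^+ m.

Let mesh_gt0 m : 0 < mesh m.
Proof. by rewrite exprn_gt0// invr_gt0. Qed.

Let mesh_small (eps : R) : 0 < eps -> exists m, mesh m < eps.
Proof.
move=> e0; exists (Num.truncn eps^-1).+1.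
rewrite /mesh exprVn invf_plt ?posrE ?exprn_gt0//.
apply: lt_trans (truncnS_gt _) _.
by rewrite -natrX ltr_nat ltn_expl.
Qed.

(** The count is integer valued and right-continuous, hence constant on a short
    interval after [t].  A negative surplus at [t] therefore remains negative
    until a dyadic time shortly after [t]. *)
Lemma survives_bigcap : survives = \bigcap_m grid_survives (mesh m).
Proof.
apply/seteqP; split => [w S m _ j|w G t t0].
  have [->|j0] := posnP j.
    by rewrite mul0r mulr0 /claims (count_at0 M_levy) total0 subr0.
  by apply: S; rewrite mulr_gt0// ltr0n.
have [_ _ _ _ /(_ w) [rc _]] := M_levy.
have /cvgrPdist_lt/(_ 1 ltr01)/nbhs_ballP[del /= del0 near_t] := rc t (ltW t0).
have count_t s : t < s -> s < t + del -> M s w = M t w.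
  move=> ts std; have := near_t s; rewrite /ball/= ltr_distlC ltrBlDr.
  move=> /(_ _ ts); rewrite (lt_trans ts) ?ltrDl// std => /(_ isT).
  rewrite ltr_distlC ltrBlDr !natr1 !ltr_nat !ltnS => /andP[lo hi].
  by apply/eqP; rewrite eqn_leq hi lo.
rewrite leNgt; apply/negP => neg.
have e0 : 0 < Num.min del ((claims t w - c * t) / c).
  by rewrite lt_min del0 divr_gt0// subr_gt0 -subr_lt0.
have [m] := mesh_small e0; rewrite lt_min => /andP[md mc].
(* The first multiple of [mesh m] after [t]. *)
pose j := (Num.truncn (t / mesh m)).+1.
have ts : t < j%:R * mesh m by rewrite -ltr_pdivrMr// truncnS_gt.
have st : j%:R * mesh m <= t + mesh m.
  rewrite -natr1 mulrDl mul1r lerD2r -ler_pdivlMr//.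
  by rewrite truncn_le// divr_ge0// ltW.
have := G m I j; rewrite /claims (count_t _ ts); last first.
  by rewrite (le_lt_trans st)// ltrD2l.
rewrite -/(claims t w) leNgt => /negP; apply.
rewrite ltr_pdivlMr// in mc.
have := ler_wpM2l (ltW c_gt0) st; rewrite mulrDr; lra.
Qed.

Lemma measurable_survives : measurable survives.
Proof.
rewrite survives_bigcap; apply: bigcap_measurableType => m _.
exact: measurable_grid_survives.
Qed.

(** The dyadic grids are nested, so the grid survival events decrease. *)
Lemma survives_probability : P survives = (1 - rho)%:E.
Proof.
have cvgP : P (grid_survives (mesh m)) @[m --> \oo] --> P survives.
  rewrite survives_bigcap; apply: nonincreasing_cvg_mu.
  - rewrite (le_lt_trans (probability_le1 _ _)) ?ltry//.
    exact: measurable_grid_survives.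
  - by move=> m; exact: measurable_grid_survives.
  - by rewrite -survives_bigcap; exact: measurable_survives.
  - apply/nonincreasing_seqP => m; apply/subsetPset => w G j.
    have <- : (j * 2)%:R * mesh m.+1 = j%:R * mesh m.
      by rewrite natrM /mesh exprS; field.
    exact: G.
pose u m := ultimate_survival P (fun w => c * mesh m - claims (mesh m) w) 0.
have Pu m : P (grid_survives (mesh m)) = (u m)%:E.
  exact: grid_survives_probability.
have cvgu : u m @[m --> \oo] --> 1 - rho.
  have mesh0 : mesh m @[m --> \oo] --> 0.
    by apply: cvg_expr; rewrite ger0_norm ?invr_ge0// invf_lt1// ltr1n.
  apply: (@squeeze_cvgr _ \oo _ _ (fun=> 1 - rho)
    (fun m => (1 - rho) * expR (Lambda * mesh m))).
  - by apply: nearW => m; exact: grid_survives_bounds.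
  - exact: cvg_cst.
  - rewrite -[X in _ --> X]mulr1; apply: cvgMr.
    rewrite -expR0; apply: continuous_cvg; first exact: continuous_expR.
    by rewrite -(mulr0 Lambda); exact: cvgMr.
apply: (cvg_unique _ cvgP) => //; rewrite (funext Pu).
by apply: cvg_EFin; first exact: nearW.
Qed.

Lemma ruin_complement :
  [set w | (ruin_time (surplus 0 (risk_process c (fun t => M t) Z)) w < +oo)%E] =
  ~` survives.
Proof.
apply/seteqP; split => w /=.
  move=> lt S; move: lt; rewrite /ruin_time.
  rewrite (_ : [set _ | _ in _] = set0) ?ereal_inf0 ?ltxx//.
  apply/seteqP; split => // r [t [t0 neg] _]; exfalso; move: neg.
  by rewrite /surplus add0r ltNge; apply/negP/negPn; exact: S.
move=> nS; have [t /not_implyP[t0 neg]] := (existsNP _).2 nS.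
apply: le_lt_trans (ltry t); apply: ereal_inf_lbound; exists t => //.
by split=> //; rewrite /surplus add0r ltNge; exact/negP.
Qed.

End ruin.

(** * Ruin probability without initial capital *)

Theorem corollary5p1
    (R : realType) (d : measure_display) (T : measurableType d)
    (P : probability T R)
    (k : nat) (hk : (1 <= k)%N)
    (lambda : 'I_k -> R) (hlambda : forall j, 0 < lambda j)
    (c : R) (hc : 0 < c)
    (M : R -> {RV P >-> nat})
    (hM : generalized_counting_process lambda M)
    (F : probability R R)
    (Z : nat -> {RV P >-> R})
    (hZpos : forall j, {ae P, forall w, 0 < Z j w})
    (hZind : mutually_independent P (fun j => Z j : T -> R))
    (hZlaw : forall j (A : set R), measurable A -> distribution P (Z j) A = F A)
    (hMZ : independent_families P (@nneg_times R) (fun t => M t : T -> nat)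
             [set: nat] (fun j => Z j : T -> R))
    (mu : R) (hmu : forall j, ('E_P[Z j] = mu%:E)%E)
    (* net profit condition: for mu * sum > c the formula would exceed 1 *)
    (hnet : mu * (\sum_(j < k) j.+1%:R * lambda j) <= c) :
  ruin_probability P (risk_process c M Z) 0 =
  (mu / c * \sum_(j < k) j.+1%:R * lambda j)%:E.
Proof.
have mabs j : measurable_fun setT (fun w => `|Z j w|).
  by apply: measurableT_comp; [exact: normr_measurable|exact: measurable_funPT].
(* Claims are positive only almost surely; their absolute values have the same
   law properties and are nonnegative everywhere. *)
pose absZ j : {RV P >-> R} :=
  HB.pack (fun w => `|Z j w|) (isMeasurableFun.Build _ _ _ _ _ (mabs j)).
have Zpos : {ae P, forall w, forall j, 0 < Z j w} by exact/ae_foralln.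
have mabsB (B : set R) : measurable B -> measurable (Num.norm @^-1` B : set R).
  by move=> mB; rewrite -[_ @^-1` _]setTI; exact: normr_measurable.
have absZ_law j (B : set R) : measurable B ->
    P (absZ j @^-1` B) = P (absZ 0%N @^-1` B).
  move=> mB; apply: (etrans (hZlaw j _ (mabsB B mB))).
  exact/esym/(hZlaw 0%N _ (mabsB B mB)).
have absZ_ind : mutually_independent P (fun j => absZ j : T -> R).
  move=> s B us mB.
  exact: (hZind s (fun j => Num.norm @^-1` B j) us (fun j => mabsB _ (mB j))).
have MabsZ : independent_families P (@nneg_times R) (fun t => M t : T -> nat)
    [set: nat] (fun j => absZ j : T -> R).
  move=> A B sA sB; apply: hMZ => //.
  by apply: (@preimage_history _ _ _ _ _ _ _ _ _ (Num.norm : R -> R)) => //;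
    exact: normr_measurable.
have mean_absZ j : (\int[P]_w (absZ j w)%:E = mu%:E)%E.
  rewrite -(hmu j) unlock; apply: ae_eq_integral => //.
  - exact/measurable_EFinP.
  - exact/measurable_EFinP.
  - by apply: filterS (hZpos j) => w Zw _ /=; rewrite gtr0_norm.
have absZ_ge0 j w : 0 <= absZ j w by exact: normr_ge0.
have surv := survives_probability hk hlambda hc hM absZ_ge0
  absZ_ind absZ_law MabsZ mean_absZ hnet.
rewrite /ruin_probability ruin_complement.
have mS := measurable_survives Z hc hM.
rewrite probability_setC//.
have -> : P (survives c M Z) = P (survives c M absZ).
  apply: ae_eq_measure; [exact: mS|exact: measurable_survives absZ hc hM|].
  apply: filterS Zpos => w Zw.
  have e t : total Z (M t w) w = total absZ (M t w) w.
    by apply: eq_bigr => j _; rewrite /= gtr0_norm.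
  by split => S t t0; have := S t t0; rewrite e.
by rewrite surv -EFinB; congr (_%:E); ring.
Qed.
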